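(* Let $A$ be a Koszul algebra, $f\in A_2$ a regular normal element, and $B=A/(f)$ (which is again Koszul). Let $\ell\ge 2$. If $A$ satisfies the (G1) condition and is point-exact up to degree $\ell$, then $B$ also satisfies the (G1) condition and is point-exact up to degree $\ell$.
   Context: $\Bbbk$ is an algebraically closed field of characteristic $0$; all algebras are over $\Bbbk$. A connected graded algebra $A$ ($A_0=\Bbbk$, $A_i=0$ for $i<0$) is Koszul if the right module $\Bbbk_A=A/A_{\ge1}$ has a linear resolution, i.e. a graded projective resolution whose $i$-th term is generated in degree $i$. An element $f$ is regular if $af=0$ or $fa=0$ implies $a=0$; normal if $Af=fA$. If $f\in A_2$ is regular normal and $A$ is Koszul, then $A/(f)$ is Koszul (known). A Koszul algebra is quadratic: $A=T(V)/(R)=\Bbbk\langle x_1,\dots,x_n\rangle/(f_1,\dots,f_r)$, where $V=A_1$ is finite-dimensional with basis $x_1,\dots,x_n$ and $R\subset V^{\otimes2}$ has basis $f_1,\dots,f_r$. Write $f_i=\sum_j x_jf_{ji}=\sum_j g_{ij}x_j$ with $f_{ji},g_{ij}\in V$. The right module $\Bbbk_A$ has a linear resolution $P_\bullet$ with $P_i=A(-i)^{\oplus s_i}$ and differentials $d_i:P_i\to P_{i-1}$ given by matrices over $V$ ($s_0=1$, $s_1=n$, $s_2=r$, $d_1=(x_1,\dots,x_n)$, $d_2=(f_{ji})_{j,i}\in\mathbb M_{n\times r}(V)$). The left module ${}_A\Bbbk$ has a linear resolution $Q_\bullet$ with $Q_i=A(-i)^{\oplus s_i}$ and differentials $h_i$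 given by matrices over $V$ ($h_1=(x_1,\dots,x_n)^t$, $h_2=(g_{ij})\in\mathbb M_{r\times n}(V)$, with $h_{i+1}h_i=0$ over $A$). For a matrix $M$ over $V$ and $p=(p_1:\cdots:p_n)\in\mathbb P(V^* )=\mathbb P^{n-1}$, $M_p$ is the matrix over $\Bbbk$ (up to scalar) obtained by substituting $x_i\mapsto p_i$. Define $$X_A=\{p:\operatorname{rank}_\Bbbk(d_2)_p<n\},\qquad {}_AX=\{p:\operatorname{rank}_\Bbbk(h_2)_p<n\}.$$ These are independent of choices; Koszul algebras under consideration (here $A$ and $B$) are always assumed to have $X_A$ and ${}_AX$ nonempty. $A$ is right point-exact at degree $i\ge1$ if $\operatorname{rank}_\Bbbk(d_i)_p+\operatorname{rank}_\Bbbk(d_{i+1})_p=s_i$ for all $p\in X_A$; left point-exact at degree $i$ if $\operatorname{rank}_\Bbbk(h_i)_p+\operatorname{rank}_\Bbbk(h_{i+1})_p=s_i$ for all $p\in{}_AX$; point-exact at degree $i$ if both. It is point-exact up to degree $\ell$ if it is point-exact at every degree $1\le i\le\ell$. (G1) condition for a quadratic algebra $A=T(V)/(R)$: with $\mathcal V(R)=\{(p,q)\in\mathbb P(V^* )\times\mathbb P(V^* ): g(p,q)=0\ \forall g\in R\}$ (where $g=\sum a_{ij}x_i\otimes x_j$ is evaluated as $\sum a_{ij}p_iq_j$), there are a projective variety $E\subset\mathbb P(V^* )$ (a closed subset with reduced structure, possibly reducible) and $\sigma\in\operatorname{Aut}_\Bbbk E$ with $\mathcal V(R)=\{(p,\sigma(p)):p\in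 E\}$. *)

(* Defs.v *)
From HB Require Import structures.
From mathcomp Require Import all_boot all_order all_algebra.
From mathcomp Require Import mpoly.

Set Implicit Arguments.
Unset Strict Implicit.
Unset Printing Implicit Defensive.

Import GRing.Theory.
Local Open Scope ring_scope.

(** * Gradings *)

(* [M] is the direct sum of the additive subgroups [g i], [i : I]. *)
Record is_grading (I : eqType) (M : zmodType) (g : I -> M -> Prop) : Prop :=
  IsGrading {
    grading0 : forall i, g i 0;
    gradingB : forall i u v, g i u -> g i v -> g i (u - v);
    grading_span : forall u, exists (r : seq I) (c : I -> M),
      (forall i, g i (c i)) /\ u = \sum_(i <- r) c i;
    grading_free : forall (r : seq I) (c : I -> M), uniq r ->
      (forall i, g i (c i)) -> \sum_(i <- r) c i = 0 ->
      forall i, i \in r -> c i = 0 }.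

(* Since [A_0 = k] and [A_0 A_i] is contained in [A_i], the components are
   automatically [k]-subspaces. *)
Record connected_graded (k : fieldType) (A : algType k)
    (gA : nat -> A -> Prop) : Prop := ConnectedGraded {
  cg_grading : is_grading gA;
  cg_mul : forall i j a b, gA i a -> gA j b -> gA (i + j)%N (a * b);
  cg_degree0 : forall a, gA 0%N a <-> exists c : k, a = c%:A }.

(* The augmentation ideal [A_{>= 1}]. *)
Definition positive_part (A : zmodType) (gA : nat -> A -> Prop) (a : A) : Prop :=
  exists (N : nat) (c : nat -> A),
    (forall i, gA i.+1 (c i)) /\ a = \sum_(i < N) c i.

(** * Koszul algebras *)

(* Left modules over a graded ring [S]; for right modules over [A], take
   [S := A^c]. *)
Record graded_module (S : nzRingType) (gS : nat -> S -> Prop) (M : lmodType S)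
    (gM : int -> M -> Prop) : Prop := GradedModule {
  gm_grading : is_grading gM;
  gm_act : forall (i : nat) (j : int) a m,
    gS i a -> gM j m -> gM (j + i%:Z) (a *: m) }.

Definition graded_hom (S : nzRingType) (M N : lmodType S)
    (gM : int -> M -> Prop) (gN : int -> N -> Prop) (u : M -> N) : Prop :=
  forall j m, gM j m -> gN j (u m).

Definition graded_projective (S : nzRingType) (gS : nat -> S -> Prop)
    (P : lmodType S) (gP : int -> P -> Prop) : Prop :=
  forall (M N : lmodType S) (gM : int -> M -> Prop) (gN : int -> N -> Prop)
         (u : {linear M -> N}) (v : {linear P -> N}),
    graded_module gS gM -> graded_module gS gN ->
    graded_hom gM gN u -> graded_hom gP gN v ->
    (forall y, exists x, u x = y) ->
  exists2 w : {linear P -> M}, graded_hom gP gM w & forall p, u (w p) = v p.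

Definition generated_in_degree (S : nzRingType) (M : lmodType S)
    (gM : int -> M -> Prop) (i : int) : Prop :=
  forall m : M, exists (N : nat) (a : 'I_N -> S) (w : 'I_N -> M),
    (forall t, gM i (w t)) /\ m = \sum_t a t *: w t.

(* [q : S -> K] exhibits [K] as the trivial module [S / S_{>= 1}], which sits
   in degree 0; [P] with [d] and [eps] is a graded projective resolution of [K]
   whose [i]-th term is generated in degree [i]. *)
Definition has_linear_resolution (S : nzRingType) (gS : nat -> S -> Prop) : Prop :=
  exists (K : lmodType S) (q : {linear S^o -> K})
         (P : nat -> lmodType S) (gP : forall i, int -> P i -> Prop)
         (eps : {linear P 0%N -> K}) (d : forall i, {linear P i.+1 -> P i}),
    [/\ (forall y, exists a, q a = y)
          /\ (forall a : S, q a = 0 <-> positive_part gS a),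
        forall i, [/\ graded_module gS (gP i), graded_projective gS (gP i)
                    & generated_in_degree (gP i) i%:Z],
        graded_hom (gP 0%N) (fun j y => j = 0 \/ y = 0) eps
          /\ (forall i, graded_hom (gP i.+1) (gP i) (d i)),
        (forall y, exists m, eps m = y)
          /\ (forall m, eps m = 0 <-> exists m', m = d 0%N m')
      & forall i m, d i m = 0 <-> exists m', m = d i.+1 m'].

Definition koszul (k : fieldType) (A : algType k) (gA : nat -> A -> Prop) : Prop :=
  connected_graded gA /\ @has_linear_resolution A^c gA.

(** * Regular normal elements and quotients *)

Definition regular_elt (A : nzRingType) (f : A) : Prop :=
  forall a, a * f = 0 \/ f * a = 0 -> a = 0.

Definition normal_elt (A : nzRingType) (f : A) : Prop :=
  forall c, (exists a, c = a * f) <-> (exists b, c = f * b).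

Definition two_sided_ideal (A : nzRingType) (f a : A) : Prop :=
  exists (N : nat) (u v : 'I_N -> A), a = \sum_t u t * f * v t.

Definition is_quotient_by (k : fieldType) (A B : algType k) (f : A)
    (pi : {lrmorphism A -> B}) : Prop :=
  (forall b, exists a, pi a = b)
  /\ (forall a, pi a = 0 <-> two_sided_ideal f a).

Definition image_grading (A B : Type) (pi : A -> B) (gA : nat -> A -> Prop) :
    nat -> B -> Prop :=
  fun i b => exists2 a, gA i a & b = pi a.

(** * Linear forms, quadratic relations, and the schemes of points

   Once a basis [x] of [V = A_1] is chosen, an element of [V] is given by its
   row of coordinates, so that matrices over [V] are elements of
   ['M['rV[k]_n]_(a, b)], and an element of [V (x) V] is given by the matrix of
   its coordinates on the [x_i (x) x_j].  A point of the
   projective space of the dual of [V] is given by a nonzero row of homogeneous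
   coordinates. *)

Section LinearForms.
Variables (k : fieldType) (n : nat).

Definition lform (A : lmodType k) (x : 'I_n -> A) (v : 'rV[k]_n) : A :=
  \sum_j v 0 j *: x j.

Definition is_basis_of (A : lmodType k) (x : 'I_n -> A) (V : A -> Prop) : Prop :=
  injective (lform x) /\ (forall a, V a <-> exists v, a = lform x v).

Definition mx_over (A : lmodType k) (x : 'I_n -> A) a b
    (M : 'M['rV[k]_n]_(a, b)) : 'M[A]_(a, b) :=
  map_mx (lform x) M.

(* The matrix [M_p], obtained by substituting [x_i |-> p_i]. *)
Definition mx_at (p : 'rV[k]_n) a b (M : 'M['rV[k]_n]_(a, b)) : 'M[k]_(a, b) :=
  map_mx (fun v : 'rV[k]_n => \sum_j v 0 j * p 0 j) M.

(* The space of relations [R], as the kernel of the multiplication map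
   from [V (x) V] to [A_2]. *)
Definition relation (A : algType k) (x : 'I_n -> A) (g : 'M[k]_n) : Prop :=
  \sum_i \sum_j g i j *: (x i * x j) = 0.

Definition relation_basis (A : algType k) (x : 'I_n -> A) r
    (F : 'I_r -> 'M[k]_n) : Prop :=
  row_free (\matrix_(i < r) mxvec (F i))
  /\ (forall g, relation x g <-> (mxvec g <= \matrix_(i < r) mxvec (F i))%MS).

(* [(f_{ji})_{j,i}] where [f_i = \sum_j x_j f_{ji}]. *)
Definition right_relation_mx r (F : 'I_r -> 'M[k]_n) : 'M['rV[k]_n]_(n, r) :=
  \matrix_(j, i) row j (F i).

(* [(g_{ij})_{i,j}] where [f_i = \sum_j g_{ij} x_j]. *)
Definition left_relation_mx r (F : 'I_r -> 'M[k]_n) : 'M['rV[k]_n]_(r, n) :=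
  \matrix_(i, j) (col j (F i))^T.

(* [X_A]; it does not depend on the basis [F] of [R]. *)
Definition right_points (A : algType k) (x : 'I_n -> A) (p : 'rV[k]_n) : Prop :=
  p != 0 /\ exists r (F : 'I_r -> 'M[k]_n),
    relation_basis x F /\ (\rank (mx_at p (right_relation_mx F)) < n)%N.

(* [_A X] *)
Definition left_points (A : algType k) (x : 'I_n -> A) (p : 'rV[k]_n) : Prop :=
  p != 0 /\ exists r (F : 'I_r -> 'M[k]_n),
    relation_basis x F /\ (\rank (mx_at p (left_relation_mx F)) < n)%N.

(** * Point-exactness *)

(* The ranks [s_i] of the terms of a resolution, with [s_0 = 1] and [s_1 = n]
   built in so that the first differentials typecheck. *)
Definition res_rank (s : nat -> nat) (i : nat) : nat :=
  match i with 0 => 1%N | 1 => n | j.+2 => s j end.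

(* [d i] stands for the differential [d_{i+1}], which acts on column vectors
   (elements of the free right module) by left multiplication. *)
Definition right_linear_resolution (A : algType k) (gA : nat -> A -> Prop)
    (x : 'I_n -> A) (s : nat -> nat)
    (d : forall i, 'M['rV[k]_n]_(res_rank s i, res_rank s i.+1)) : Prop :=
  [/\ d 0%N = \row_(j < n) delta_mx 0 j,
      forall a : A, positive_part gA a <->
        exists w : 'cV[A]_(res_rank s 1), const_mx a = mx_over x (d 0%N) *m w
    & forall i (v : 'cV[A]_(res_rank s i.+1)),
        mx_over x (d i) *m v = 0 <->
        exists w : 'cV[A]_(res_rank s i.+2), v = mx_over x (d i.+1) *m w].

(* [h i] stands for the differential [h_{i+1}], which acts on row vectors
   (elements of the free left module) by right multiplication. *)
Definition left_linear_resolution (A : algType k) (gA : nat -> A -> Prop)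
    (x : 'I_n -> A) (s : nat -> nat)
    (h : forall i, 'M['rV[k]_n]_(res_rank s i.+1, res_rank s i)) : Prop :=
  [/\ h 0%N = \col_(j < n) delta_mx 0 j,
      forall a : A, positive_part gA a <->
        exists w : 'rV[A]_(res_rank s 1), const_mx a = w *m mx_over x (h 0%N)
    & forall i (v : 'rV[A]_(res_rank s i.+1)),
        v *m mx_over x (h i) = 0 <->
        exists w : 'rV[A]_(res_rank s i.+2), v = w *m mx_over x (h i.+1)].

(* Exactness at degree [i.+1]: the differentials [d_{i+1}], [d_{i+2}] are
   [d i], [d i.+1]. *)
Definition right_point_exact_atS (A : algType k) (x : 'I_n -> A) (s : nat -> nat)
    (d : forall i, 'M['rV[k]_n]_(res_rank s i, res_rank s i.+1)) (i : nat) : Prop :=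
  forall p, right_points x p ->
    (\rank (mx_at p (d i)) + \rank (mx_at p (d i.+1)))%N = res_rank s i.+1.

Definition left_point_exact_atS (A : algType k) (x : 'I_n -> A) (s : nat -> nat)
    (h : forall i, 'M['rV[k]_n]_(res_rank s i.+1, res_rank s i)) (i : nat) : Prop :=
  forall p, left_points x p ->
    (\rank (mx_at p (h i)) + \rank (mx_at p (h i.+1)))%N = res_rank s i.+1.

(* Linear free resolutions of a Koszul algebra are unique up to isomorphism, so
   the choice of resolutions is immaterial.  The degrees [1 <= j <= l] are the
   [i.+1] with [i < l]. *)
Definition point_exact_upto (A : algType k) (gA : nat -> A -> Prop)
    (x : 'I_n -> A) (l : nat) : Prop :=
  exists (s : nat -> nat)
         (d : forall i, 'M['rV[k]_n]_(res_rank s i, res_rank s i.+1))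
         (h : forall i, 'M['rV[k]_n]_(res_rank s i.+1, res_rank s i)),
    [/\ right_linear_resolution gA x d,
        left_linear_resolution gA x h
      & forall i, (i < l)%N ->
          right_point_exact_atS x d i /\ left_point_exact_atS x h i].

(** * The condition (G1) *)

Definition same_point (p q : 'rV[k]_n) : Prop :=
  exists2 c : k, c != 0 & q = c *: p.

Definition mpoly_at (g : {mpoly k[n]}) (p : 'rV[k]_n) : k :=
  g.@[fun i => p 0 i].

Definition closed_subset (E : 'rV[k]_n -> Prop) : Prop :=
  exists S : {mpoly k[n]} -> Prop,
    (forall g, S g -> exists d, g \is d.-homog)
    /\ (forall p, E p <-> p != 0 /\ (forall g, S g -> mpoly_at g p = 0)).

(* A morphism of varieties from [E] to [E'], acting on homogeneous coordinates:
   locally it is given by homogeneous polynomials of the same degree. *)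
Definition variety_morphism (E E' : 'rV[k]_n -> Prop)
    (sigma : 'rV[k]_n -> 'rV[k]_n) : Prop :=
  (forall p, E p -> E' (sigma p))
  /\ forall p, E p -> exists (d : nat) (phi : 'I_n -> {mpoly k[n]}),
       let Phi q : 'rV[k]_n := \row_i mpoly_at (phi i) q in
       [/\ forall i, phi i \is d.-homog,
           Phi p != 0
         & forall q, E q -> Phi q != 0 -> same_point (Phi q) (sigma q)].

Definition variety_automorphism (E : 'rV[k]_n -> Prop)
    (sigma : 'rV[k]_n -> 'rV[k]_n) : Prop :=
  variety_morphism E E sigma /\
  exists2 tau, variety_morphism E E tau &
    forall p, E p -> same_point p (tau (sigma p)) /\ same_point p (sigma (tau p)).

(* The zero locus of [R] in the product of two copies of projective space. *)
Definition relation_zeros (A : algType k) (x : 'I_n -> A) (p q : 'rV[k]_n) : Prop :=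
  [/\ p != 0, q != 0
    & forall g, relation x g -> \sum_i \sum_j g i j * (p 0 i * q 0 j) = 0].

Definition G1 (A : algType k) (x : 'I_n -> A) : Prop :=
  exists (E : 'rV[k]_n -> Prop) (sigma : 'rV[k]_n -> 'rV[k]_n),
    [/\ closed_subset E, variety_automorphism E sigma
      & forall p q, relation_zeros x p q <-> E p /\ same_point (sigma p) q].

End LinearForms.

(* Main.v *)
Require Import Defs.
From HB Require Import structures.
From mathcomp Require Import all_boot all_order all_algebra.
From mathcomp Require Import perm mpoly.
From Stdlib Require Import ClassicalEpsilon.

Set Implicit Arguments.
Unset Strict Implicit.
Unset Printing Implicit Defensive.

Import GRing.Theory.
Local Open Scope ring_scope.

(** The reduction [P (x) B] of the linear resolution [P] of [A] has homology [k]
    in degrees 0 and 1 only, the latter generated by the class of a vector [F]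
    of linear forms with [f = sum x_j F_j].  A linear resolution of the trivial
    [B]-module is therefore the cone of a lift of [1 |-> F], from itself shifted
    by two, into [P (x) B]; its differentials are block triangular with linear
    entries.  At a point of [X_B] the rank of a block triangular matrix is at
    least the sum of the ranks of its diagonal blocks, which gives one inequality
    in point-exactness.  The other comes from the identities [D_i D_(i+1) = 0],
    evaluated at the pairs [(o, p)] of zeros of the relations of [B]: they bound
    [rank D_i(o) + rank D_(i+1)(p)], and the rank of [D_i] turns out to be constant
    on [X_B], by induction on [i].

    For (G1), evaluating [f v = w f] at [(p, s p, s^2 p)] gives
    [f(p, s p) v(s^2 p) = w(p) f(s p, s^2 p)], so that the automorphism [s] of [E]
    preserves the locus where [f(p, s p) = 0].  The left-hand statements are the
    right-hand ones for the converse algebra. *)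

(** * Homogeneous components *)

Section Grading.
Variables (M : zmodType) (g : nat -> M -> Prop).
Hypothesis g_grading : is_grading g.

Lemma gradingN i u : g i u -> g i (- u).
Proof. by rewrite -sub0r; apply: gradingB => //; apply: grading0. Qed.

Lemma gradingD i u v : g i u -> g i v -> g i (u + v).
Proof. by move=> gu /gradingN gv; rewrite -[v]opprK; apply: gradingB. Qed.

Lemma grading_sum (I : Type) (r : seq I) (F : I -> M) i :
  (forall t, g i (F t)) -> g i (\sum_(t <- r) F t).
Proof. by move=> gF; elim/big_ind: _ => //; [apply: grading0 | apply: gradingD]. Qed.

(** Asking for the equality beyond a bound, and not at a single length, lets two decompositions be
    added under a common bound. *)
Definition decomposes (u : M) (c : nat -> M) : Prop :=
  (forall i, g i (c i)) /\
  exists N0, forall N, (N0 <= N)%N -> u = \sum_(i < N) c i.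

Lemma decomposesD u v c e :
  decomposes u c -> decomposes v e -> decomposes (u + v) (fun i => c i + e i).
Proof.
move=> [gc [N Nc]] [ge [N' Ne]]; split=> [i|]; first exact: gradingD.
exists (maxn N N') => K; rewrite geq_max => /andP[NK N'K].
by rewrite big_split /= -(Nc _ NK) -(Ne _ N'K).
Qed.

Lemma decomposesN u c : decomposes u c -> decomposes (- u) (fun i => - c i).
Proof.
move=> [gc [N Nc]]; split=> [i|]; first exact: gradingN.
by exists N => K NK; rewrite sumrN -(Nc _ NK).
Qed.

Lemma decomposes_homog i u :
  g i u -> decomposes u (fun j => if i == j then u else 0).
Proof.
move=> gu; split=> [j|]; first by case: eqP => [<-|_] //; apply: grading0.
exists i.+1 => N iN; rewrite (bigD1 (Ordinal iN)) //= eqxx big1 ?addr0 // => j.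
by rewrite -val_eqE /= eq_sym => /negPf->.
Qed.

Lemma decomposes_exists u : exists c, decomposes u c.
Proof.
have [r [c [gc ->]]] := grading_span g_grading u.
elim/big_ind: _ => [|v w [cv Dv] [cw Dw]|i _].
- exists (fun=> 0); split=> [i|]; first exact: grading0.
  by exists 0%N => N _; rewrite big1.
- by exists (fun i => cv i + cw i); apply: decomposesD.
- by exists (fun j => if i == j then c i else 0); apply: decomposes_homog.
Qed.

Lemma decomposes_uniq u c e : decomposes u c -> decomposes u e -> c =1 e.
Proof.
move=> Dc /decomposesN De i; have := decomposesD Dc De.
rewrite subrr => -[gce [N Nce]]; apply/eqP; rewrite -subr_eq0; apply/eqP.
apply: (grading_free g_grading (iota_uniq 0 (maxn N i.+1)) gce).
  by rewrite [RHS](Nce _ (leq_maxl N i.+1)) -(big_mkord xpredT (fun i => c i - e i))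
    /index_iota subn0.
by rewrite mem_iota /= add0n leq_maxr.
Qed.

(** [grading_span] only asserts existence, so the projection is taken by choice; [decomposes_uniq]
    makes it independent of that choice. *)
Definition component (i : nat) (u : M) : M :=
  proj1_sig (constructive_indefinite_description _ (decomposes_exists u)) i.

Lemma component_decomposes u : decomposes u (component^~ u).
Proof.
by rewrite /component; case: constructive_indefinite_description.
Qed.

Lemma component_in i u : g i (component i u).
Proof. by have [] := component_decomposes u. Qed.

Lemma componentB i : {morph component i : u v / u - v}.
Proof.
move=> u v; have /decomposesN := component_decomposes v.
move=> /(decomposesD (component_decomposes u)).
by move/(decomposes_uniq (component_decomposes (u - v))).
Qed.

Lemma component0 i : component i 0 = 0.
Proof. by rewrite -{1}[0](subrr 0) componentB subrr. Qed.

Lemma componentD i : {morph component i : u v / u + v}.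
Proof.
by move=> u v; rewrite -{1}[v]opprK componentB -{1}[- v]sub0r componentB component0
  sub0r opprK.
Qed.

Lemma component_sum i (I : Type) (r : seq I) (F : I -> M) :
  component i (\sum_(t <- r) F t) = \sum_(t <- r) component i (F t).
Proof. exact: (big_morph _ (componentD i) (component0 i)). Qed.

Lemma component_homog i j u :
  g i u -> component j u = if i == j then u else 0.
Proof.
by move/decomposes_homog/(decomposes_uniq (component_decomposes u)).
Qed.

Lemma component_id i u : g i u -> component i u = u.
Proof. by move/component_homog->; rewrite eqxx. Qed.

Lemma component_other i j u : i != j -> g i u -> component j u = 0.
Proof. by move/negPf=> ij /component_homog->; rewrite ij. Qed.

Lemma positive_partP u : positive_part g u <-> component 0 u = 0.
Proof.
split=> [[N [c [gc ->]]]|u0].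
  by rewrite component_sum big1 // => i _; rewrite (component_homog _ (gc i)).
have [_ [N Nu]] := component_decomposes u.
exists N, (fun i => component i.+1 u); split=> [i|]; first exact: component_in.
by rewrite {1}(Nu N.+1) // big_ord_recl u0 add0r.
Qed.

End Grading.

(** * Components of products in a graded algebra *)

Section GradedAlgebra.
Variables (k : fieldType) (A : algType k) (gA : nat -> A -> Prop).
Hypothesis cgA : connected_graded gA.
Let grA := cg_grading cgA.
Local Notation cp := (component grA).

Lemma component_mull i j a b : gA i a -> cp (i + j) (a * b) = a * cp j b.
Proof.
move=> ga; have [_ [N Nb]] := component_decomposes grA b.
rewrite [in LHS](Nb (maxn N j.+1)) ?leq_maxl // mulr_sumr component_sum.
rewrite (bigD1 (Ordinal (leq_maxr N j.+1))) //= big1 ?addr0 => [|t tj].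
  by apply/component_id/(cg_mul cgA ga); apply: component_in.
rewrite (component_homog _ _ (cg_mul cgA ga (component_in grA t b))) eqn_add2l.
by move: tj; rewrite -val_eqE /= => /negPf->.
Qed.

Lemma component_mulr i j a b : gA j b -> cp (i + j) (a * b) = cp i a * b.
Proof.
move=> gb; have [_ [N Na]] := component_decomposes grA a.
rewrite [in LHS](Na (maxn N i.+1)) ?leq_maxl // mulr_suml component_sum.
rewrite (bigD1 (Ordinal (leq_maxr N i.+1))) //= big1 ?addr0 => [|t tj].
  by apply/component_id/(cg_mul cgA _ gb); apply: component_in.
rewrite (component_homog _ _ (cg_mul cgA (component_in grA t a) gb)) eqn_add2r.
by move: tj; rewrite -val_eqE /= => /negPf->.
Qed.

Lemma degree0P a : gA 0%N a -> exists c : k, a = c%:A.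
Proof. by move/(cg_degree0 cgA). Qed.

Lemma gradingZ i (c : k) a : gA i a -> gA i (c *: a).
Proof.
move=> ga; rewrite -mulr_algl -[i]add0n; apply: (cg_mul cgA) => //.
by apply/(cg_degree0 cgA); exists c.
Qed.

End GradedAlgebra.

(** * Bases of subspaces and ranks of block matrices *)

Lemma subspace_basis (k : fieldType) N (P : 'rV[k]_N -> Prop) :
  P 0 -> (forall c u v, P u -> P v -> P (c *: u + v)) ->
  exists r (M : 'M[k]_(r, N)), row_free M /\ forall v, P v <-> (v <= M)%MS.
Proof.
move=> P0 Plin.
suff [M PM]: exists M : 'M[k]_N, forall v, P v <-> (v <= M)%MS.
  exists (\rank M), (row_base M); split=> [|v]; first exact: row_base_free.
  by rewrite eq_row_base.
(* A matrix with rows in [P] is enlarged by one vector outside its row space at a time; [d] bounds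
   the codimension, which drops at each step. *)
suff grow d (M : 'M[k]_N) : (forall v, (v <= M)%MS -> P v) ->
    (N <= d + \rank M)%N -> exists M : 'M[k]_N, forall v, P v <-> (v <= M)%MS.
  by apply: (grow N 0) => [v|]; [rewrite submx0 => /eqP-> | rewrite leq_addr].
elim: d M => [|d IHd] M MP leMd.
  exists M => v; split=> [_|]; last exact: MP.
  by apply: submx_full; rewrite -col_leq_rank.
have [[v [Pv nvM]]|max] := excluded_middle_informative (exists v, P v /\ ~ (v <= M)%MS).
  apply: (IHd (M + v)%MS) => [w /sub_addsmxP[[u c] ->] | ].
    by rewrite addrC [c]mx11_scalar mul_scalar_mx; apply/Plin/MP/submxMl.
  have: (M < M + v)%MS.
    by rewrite ltmxE addsmxSl; apply/negP => /(submx_trans (addsmxSr M v)).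
  by rewrite ltmxErank => /andP[_ ltM]; rewrite (leq_trans leMd) // addSnnS leq_add2l.
exists M => v; split=> [Pv|]; last exact: MP.
by apply: NNPP => nvM; apply: max; exists v.
Qed.

(** Multiplication by [col_mx 0 1%:M] extracts the last block column, of rank [\rank R], and the
    part of the row space that it kills contains the rows of [row_mx P 0]. Rank-nullity adds the
    two. *)
Lemma rank_block_lower (k : fieldType) a b c e (P : 'M[k]_(a, b)) (Q : 'M[k]_(c, b))
    (R : 'M[k]_(c, e)) :
  (\rank P + \rank R <= \rank (block_mx P 0 Q R))%N.
Proof.
rewrite -(mxrank_mul_ker (block_mx P 0 Q R) (col_mx 0 1%:M)) mul_block_col.
rewrite !mulmx0 mulmx1 mulmx1 addr0 add0r addnC.
have -> : \rank (col_mx (0 : 'M_(a, e)) R) = \rank R by rewrite rank_col_0mx.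
rewrite leq_add2l -(rank_row_mx0 e P) mxrankS // sub_capmx; apply/andP; split.
  by rewrite block_mxEv -addsmxE addsmxSl.
by apply/sub_kermxP; rewrite mul_row_col mulmx0 mul0mx addr0.
Qed.

(** * Matrices of linear forms and zeros of the relations *)

Section LformLinear.
Variables (k : fieldType) (n : nat) (A : lmodType k) (x : 'I_n -> A).

Fact lform_is_linear : linear (lform x).
Proof.
move=> c u v; rewrite /lform scaler_sumr -big_split; apply: eq_bigr => j _.
by rewrite /= !mxE scalerDl scalerA.
Qed.
HB.instance Definition _ :=
  GRing.isLinear.Build k 'rV[k]_n A *:%R (lform x) lform_is_linear.

Lemma lform_delta j : lform x (delta_mx 0 j) = x j.
Proof.
rewrite /lform (bigD1 j) //= big1 ?addr0 => [|i ij]; rewrite mxE ?eqxx ?scale1r //.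
by rewrite (negPf ij) andbF scale0r.
Qed.

Lemma mx_over0 a b : mx_over x (0 : 'M_(a, b)) = 0.
Proof. exact: map_mx0. Qed.

Lemma mx_overN a b (M : 'M_(a, b)) : mx_over x (- M) = - mx_over x M.
Proof. exact: map_mxN. Qed.

Lemma mx_over_block a b c e (M : 'M_(a, b)) (N : 'M_(a, c)) P (Q : 'M_(e, c)) :
  mx_over x (block_mx M N P Q) =
  block_mx (mx_over x M) (mx_over x N) (mx_over x P) (mx_over x Q).
Proof. exact: map_block_mx. Qed.

Lemma mx_over_row a b c (M : 'M_(a, b)) (N : 'M_(a, c)) :
  mx_over x (row_mx M N) = row_mx (mx_over x M) (mx_over x N).
Proof. exact: map_row_mx. Qed.

Lemma mx_over_col a b c (M : 'M_(a, b)) (N : 'M_(c, b)) :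
  mx_over x (col_mx M N) = col_mx (mx_over x M) (mx_over x N).
Proof. exact: map_col_mx. Qed.

Lemma mx_over_surj (V : A -> Prop) a b (M : 'M[A]_(a, b)) :
  is_basis_of x V -> (forall i j, V (M i j)) -> exists N, M = mx_over x N.
Proof.
move=> [_ Vx] VM.
have /fin_all_exists[N MN] (i : 'I_a) : exists N : 'rV['rV[k]_n]_b,
    forall j, M i j = lform x (N 0 j).
  have /fin_all_exists[v Mv] (j : 'I_b) : exists v, M i j = lform x v by apply/Vx.
  by exists (\row_j v j) => j; rewrite mxE.
by exists (\matrix_i N i); apply/matrixP => i j; rewrite !mxE MN.
Qed.

End LformLinear.

Section MxAt.
Variables (k : fieldType) (n : nat) (p : 'rV[k]_n).

Lemma mx_at0 a b : mx_at p (0 : 'M_(a, b)) = 0.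
Proof.
by apply/matrixP => i j; rewrite !mxE big1 // => t _; rewrite mxE mul0r.
Qed.

Lemma mx_atN a b (M : 'M_(a, b)) : mx_at p (- M) = - mx_at p M.
Proof.
apply/matrixP => i j; rewrite !mxE -sumrN; apply: eq_bigr => t _.
by rewrite !mxE mulNr.
Qed.

Lemma mx_at_block a b c e (M : 'M_(a, b)) (N : 'M_(a, c)) P (Q : 'M_(e, c)) :
  mx_at p (block_mx M N P Q) =
  block_mx (mx_at p M) (mx_at p N) (mx_at p P) (mx_at p Q).
Proof. exact: map_block_mx. Qed.

Lemma mx_at_row a b c (M : 'M_(a, b)) (N : 'M_(a, c)) :
  mx_at p (row_mx M N) = row_mx (mx_at p M) (mx_at p N).
Proof. exact: map_row_mx. Qed.

Lemma mx_at_col a b c (M : 'M_(a, b)) (N : 'M_(c, b)) :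
  mx_at p (col_mx M N) = col_mx (mx_at p M) (mx_at p N).
Proof. exact: map_col_mx. Qed.

Lemma mx_at_coords : mx_at p (\row_(j < n) delta_mx 0 j) = p.
Proof.
apply/rowP => i; rewrite !mxE (bigD1 i) //= big1 ?addr0 => [|t ti].
  by rewrite mxE !eqxx mul1r.
by rewrite mxE (negPf ti) andbF mul0r.
Qed.

End MxAt.

Section Products.
Variables (k : fieldType) (n : nat) (A : algType k) (x : 'I_n -> A).

(** An entry of the product taken in the tensor square of [V]: multiplying in [A] and evaluating at
    a pair of points both factor through it. *)
Definition product_coeffs a b c (M : 'M['rV[k]_n]_(a, b)) (N : 'M['rV[k]_n]_(b, c))
  i j : 'M[k]_n := \matrix_(u, v) \sum_t M i t 0 u * N t j 0 v.

Lemma mx_over_mul a b c (M : 'M['rV[k]_n]_(a, b)) (N : 'M['rV[k]_n]_(b, c)) i j :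
  (mx_over x M *m mx_over x N) i j =
  \sum_u \sum_v product_coeffs M N i j u v *: (x u * x v).
Proof.
rewrite mxE.
under [RHS]eq_bigr => u _ do under eq_bigr => v _ do rewrite mxE scaler_suml.
under [RHS]eq_bigr => u _ do rewrite exchange_big.
rewrite [RHS]exchange_big; apply: eq_bigr => t _ /=.
rewrite !mxE /lform mulr_suml; apply: eq_bigr => u _.
rewrite mulr_sumr; apply: eq_bigr => v _.
by rewrite -scalerAl -scalerAr scalerA.
Qed.

Lemma mx_at_mul p q a b c (M : 'M['rV[k]_n]_(a, b)) (N : 'M['rV[k]_n]_(b, c)) i j :
  (mx_at p M *m mx_at q N) i j =
  \sum_u \sum_v product_coeffs M N i j u v * (p 0 u * q 0 v).
Proof.
rewrite mxE.
under [RHS]eq_bigr => u _ do under eq_bigr => v _ do rewrite mxE mulr_suml.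
under [RHS]eq_bigr => u _ do rewrite exchange_big.
rewrite [RHS]exchange_big; apply: eq_bigr => t _ /=.
rewrite !mxE mulr_suml; apply: eq_bigr => u _.
rewrite mulr_sumr; apply: eq_bigr => v _.
by rewrite mulrACA.
Qed.

Lemma relation_product a b c (M : 'M['rV[k]_n]_(a, b)) (N : 'M['rV[k]_n]_(b, c)) i j :
  mx_over x M *m mx_over x N = 0 -> relation x (product_coeffs M N i j).
Proof. by move/matrixP/(_ i j); rewrite mx_over_mul mxE. Qed.

(** The entries of a product that vanishes over [A] are relations, hence vanish at [(p, q)]. The two
    factors are evaluated at different points, so this alone gives no complex at one point. *)
Lemma mx_at_product0 p q a b c (M : 'M['rV[k]_n]_(a, b)) (N : 'M['rV[k]_n]_(b, c)) :
  relation_zeros x p q -> mx_over x M *m mx_over x N = 0 ->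
  mx_at p M *m mx_at q N = 0.
Proof.
move=> [_ _ Rpq] MN0; apply/matrixP => i j; rewrite mx_at_mul mxE.
exact/Rpq/relation_product.
Qed.

Lemma relation0 : relation x 0.
Proof. by rewrite /relation big1 // => i _; rewrite big1 // => j _; rewrite mxE scale0r. Qed.

Lemma quadratic_sum_linear c (g h : 'M[k]_n) :
  \sum_i \sum_j (c *: g + h) i j *: (x i * x j) =
  c *: (\sum_i \sum_j g i j *: (x i * x j)) + \sum_i \sum_j h i j *: (x i * x j).
Proof.
rewrite scaler_sumr -big_split; apply: eq_bigr => i _ /=.
rewrite scaler_sumr -big_split; apply: eq_bigr => j _ /=.
by rewrite !mxE scalerDl scalerA.
Qed.

Lemma relation_linear c g h : relation x g -> relation x h -> relation x (c *: g + h).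
Proof.
by rewrite /relation quadratic_sum_linear => -> ->; rewrite scaler0 addr0.
Qed.

Lemma relation_basis_exists : exists r (F : 'I_r -> 'M[k]_n), relation_basis x F.
Proof.
have [||r [M [freeM RM]]] := @subspace_basis k (n * n) (fun v => relation x (vec_mx v)).
- by rewrite linear0; apply: relation0.
- by move=> c u v Ru Rv; rewrite linearP; apply: relation_linear.
have EM : \matrix_(i < r) mxvec (vec_mx (row i M)) = M.
  by apply/row_matrixP => i; rewrite rowK vec_mxK.
exists r, (fun i => vec_mx (row i M)); split=> [|g]; rewrite EM //.
by rewrite -RM mxvecK.
Qed.

Lemma bilinear_mulmx (g : 'M[k]_n) (p q : 'rV[k]_n) :
  \sum_u \sum_v g u v * (p 0 u * q 0 v) = (p *m g *m q^T) 0 0.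
Proof.
rewrite mxE exchange_big; apply: eq_bigr => v _ /=.
rewrite !mxE mulr_suml; apply: eq_bigr => u _.
by rewrite mulrCA mulrA.
Qed.

Lemma relation_zerosE r (F : 'I_r -> 'M[k]_n) p q : relation_basis x F ->
  relation_zeros x p q <->
  [/\ p != 0, q != 0 & forall i, (p *m F i *m q^T) 0 0 = 0].
Proof.
move=> [_ RF]; split=> -[p0 q0 Z]; split=> //.
  move=> i; rewrite -bilinear_mulmx; apply/Z/RF.
  by rewrite -[mxvec _](rowK (fun i => mxvec (F i))) row_sub.
move=> g /RF/submxP[D gD]; have -> : g = \sum_i D 0 i *: F i.
  rewrite -[g]mxvecK gD mulmx_sum_row linear_sum; apply: eq_bigr => i _.
  by rewrite linearZ rowK /= mxvecK.
rewrite bilinear_mulmx mulmx_sumr mulmx_suml summxE big1 // => i _.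
by rewrite -scalemxAr -scalemxAl mxE Z mulr0.
Qed.

Lemma left_relation_at r (F : 'I_r -> 'M[k]_n) p :
  mx_at p (left_relation_mx F) = \matrix_i (p *m F i).
Proof.
apply/matrixP => i j; rewrite !mxE; apply: eq_bigr => t _.
by rewrite !mxE mulrC.
Qed.

Lemma right_relation_at r (F : 'I_r -> 'M[k]_n) p :
  mx_at p (right_relation_mx F) = (\matrix_i (p *m (F i)^T))^T.
Proof.
apply/matrixP => i j; rewrite !mxE; apply: eq_bigr => t _.
by rewrite !mxE mulrC.
Qed.

Lemma rank_ltP m (M : 'M[k]_(m, n)) :
  (\rank M < n)%N <-> exists2 q : 'rV[k]_n, q != 0 & forall i, (row i M *m q^T) 0 0 = 0.
Proof.
split=> [rM|[q q0 Mq]].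
  have /rowV0Pn[q /sub_kermxP qM q0] : kermx M^T != 0.
    by rewrite kermx_eq0 /row_free mxrank_tr neq_ltn rM.
  exists q => // i; by rewrite -row_mul -[M]trmxK -trmx_mul qM trmx0 row0 mxE.
rewrite ltn_neqAle rank_leq_col andbT; apply/negP => fullM.
have : row_free M^T by rewrite /row_free mxrank_tr.
rewrite -kermx_eq0 => /rowV0P/(_ q) q_eq0; move/eqP: q0; apply; apply: q_eq0.
apply/sub_kermxP; apply: trmx_inj; rewrite trmx_mul trmxK trmx0.
by apply/row_matrixP => i; rewrite row_mul row0; apply/matrixP => a b; rewrite !ord1 Mq mxE.
Qed.

(** The rows of [left_relation_mx F] at [p] are the [p *m F i]; a nonzero vector orthogonal to them
    is a second coordinate [q]. So the left points are the first projection of the zero locus, and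
    the right points the second, with no reference to a basis of relations. *)
Lemma left_pointsP p : left_points x p <-> exists q, relation_zeros x p q.
Proof.
split=> [[p0 [r [F [BF]]]]|[q RZ]].
  rewrite left_relation_at => /rank_ltP[q q0 Z]; exists q.
  by apply/(relation_zerosE _ _ BF); split=> // i; rewrite -(Z i) rowK.
have [p0 _ _] := RZ; split=> //.
have [r [F BF]] := relation_basis_exists; exists r, F; split=> //.
have [_ q0 Z] := (relation_zerosE p q BF).1 RZ.
by rewrite left_relation_at; apply/rank_ltP; exists q => // i; rewrite rowK.
Qed.

Lemma right_pointsP q : right_points x q <-> exists p, relation_zeros x p q.
Proof.
have E (p : 'rV[k]_n) (G : 'M[k]_n) : (p *m G *m q^T) 0 0 = (q *m G^T *m p^T) 0 0.
  by rewrite (_ : p *m G *m q^T = (q *m G^T *m p^T)^T) ?mxE // !trmx_mul !trmxK mulmxA.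
split=> [[q0 [r [F [BF]]]]|[p RZ]].
  rewrite right_relation_at mxrank_tr => /rank_ltP[p p0 Z]; exists p.
  by apply/(relation_zerosE _ _ BF); split=> // i; rewrite E -(Z i) rowK.
have [_ q0 _] := RZ; split=> //.
have [r [F BF]] := relation_basis_exists; exists r, F; split=> //.
have [p0 _ Z] := (relation_zerosE p q BF).1 RZ.
rewrite right_relation_at mxrank_tr; apply/rank_ltP; exists p => // i.
by rewrite rowK -E.
Qed.

End Products.

Lemma mul_mx_scalarE (R : nzRingType) a b (V : 'M[R]_(a, b)) (f : R) i j :
  (V *m f%:M) i j = V i j * f.
Proof.
rewrite mxE (bigD1 j) //= big1 ?addr0 => [|t tj]; rewrite mxE ?eqxx //.
by rewrite (negPf tj) mulr0n mulr0.
Qed.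

Lemma col_ext (T : Type) a b (M N : 'M[T]_(a, b)) :
  (forall j, col j M = col j N) -> M = N.
Proof. by move=> MN; apply/matrixP => i j; have /colP/(_ i) := MN j; rewrite !mxE. Qed.

Lemma col_mulmx (R : nzRingType) a b c (M : 'M[R]_(a, b)) (N : 'M[R]_(b, c)) j :
  col j (M *m N) = M *m col j N.
Proof. by apply/colP => i; rewrite !mxE; apply: eq_bigr => t _; rewrite mxE. Qed.

(** * Linear resolutions over the quotient *)

Section Cone.
Variables (k : fieldType) (n : nat) (s : nat -> nat)
  (d : forall i, 'M['rV[k]_n]_(res_rank n s i, res_rank n s i.+1))
  (F : 'M['rV[k]_n]_(res_rank n s 1, 1))
  (L : forall i a b, 'M['rV[k]_n]_(res_rank n s i, a) -> 'M['rV[k]_n]_(a, b) ->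
    'M['rV[k]_n]_(res_rank n s i.+1, b)).
Local Notation r := (res_rank n s).

(* All indices are shifted by 2: [cone_rank j.+2] and [cone_diff j.+2] are the
   [j]-th rank and the differential [D_(j+1)] of the resolution of [k] over [B],
   so that the part shifted by two is obtained from the indices below. *)
Fixpoint cone_rank j : nat :=
  match j with j'.+2 => cone_rank j' + r j' | _ => 0 end.
Local Notation U := cone_rank.

(** The differential of index [j.+2] is built from that of index [j], so the recursion carries two
    consecutive differentials and the current component of the lift. *)
Definition cone_state j : Type :=
  'M['rV[k]_n]_(U j, U j.+1) * 'M['rV[k]_n]_(U j.+1, U j.+2) * 'M['rV[k]_n]_(r j, U j.+1).

Definition next_homotopy j : cone_state j -> 'M['rV[k]_n]_(r j.+1, U j.+2) :=
  match j return cone_state j -> 'M['rV[k]_n]_(r j.+1, U j.+2) with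
  | 0 => fun=> F
  | _.+1 => fun S => L S.2 S.1.2
  end.

Fixpoint cone j : cone_state j :=
  match j return cone_state j with
  | 0 => (0, 0, 0)
  | j'.+1 => let S := cone j' in
      (S.1.2, block_mx S.1.1 0 S.2 (d j'), next_homotopy S)
  end.

Definition cone_diff j := (cone j).1.1.
Definition cone_homotopy j := (cone j).2.

Lemma cone_diffSS j :
  cone_diff j.+2 = block_mx (cone_diff j) 0 (cone_homotopy j) (d j).
Proof. by []. Qed.

Lemma cone_homotopySS j :
  cone_homotopy j.+2 = L (cone_homotopy j.+1) (cone_diff j.+2).
Proof. by []. Qed.

Lemma cone_diff2 : cone_diff 2 = d 0.
Proof.
rewrite cone_diffSS; apply/matrixP => i j.
(* [U 0] and [U 1] are zero: only the lower right block has entries. *)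
have [i0 [j0 [-> ->]]] : exists i0 j0, i = rshift 0 i0 /\ j = rshift 0 j0.
  by exists i, j; split; apply: val_inj.
by rewrite block_mxEdr; congr (d 0 _ _); apply: val_inj.
Qed.

End Cone.

Section Quotient.
Variables (k : fieldType) (A : algType k) (gA : nat -> A -> Prop).
Hypothesis cgA : connected_graded gA.
Variables (n : nat) (x : 'I_n -> A).
Hypothesis x_basis : is_basis_of x (gA 1%N).
Variable f : A.
Hypotheses (f_deg2 : gA 2%N f) (f_regular : regular_elt f) (f_normal : normal_elt f).
Variables (B : algType k) (pi : {lrmorphism A -> B}).
Hypothesis B_quot : is_quotient_by f pi.

Local Notation y := (pi \o x).
Let grA := cg_grading cgA.
Local Notation cp := (component grA).

Lemma lform_deg1 v : gA 1%N (lform x v).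
Proof. by have [_ ->] := x_basis; exists v. Qed.

Lemma deg1_lform a : gA 1%N a -> exists v, a = lform x v.
Proof. by have [_ H] := x_basis; move/H. Qed.

Lemma lform_quot v : lform y v = pi (lform x v).
Proof. by rewrite /lform linear_sum; apply: eq_bigr => j _; rewrite linearZ. Qed.

Lemma mx_over_quot a b (M : 'M_(a, b)) : mx_over y M = map_mx pi (mx_over x M).
Proof. by apply/matrixP => i j; rewrite !mxE lform_quot. Qed.

Lemma pi_f : pi f = 0.
Proof.
have [_ ->] := B_quot; exists 1%N, (fun=> 1), (fun=> 1).
by rewrite big_ord_recl big_ord0 addr0 mul1r mulr1.
Qed.

(** Normality moves each [f] to the right, so the two-sided ideal consists of left multiples of
    [f]. *)
Lemma ker_quot a : pi a = 0 <-> exists w, a = w * f.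
Proof.
split=> [|[w ->]]; last by rewrite rmorphM /= pi_f mulr0.
have [_ E] := B_quot; move/E => [N [u [v ->]]].
elim/big_ind: _ => [|a1 a2 [w1 ->] [w2 ->]|t _]; first by exists 0; rewrite mul0r.
  by exists (w1 + w2); rewrite mulrDl.
have [w vw] : exists w, f * v t = w * f by apply/f_normal; exists (v t).
by exists (u t * w); rewrite -!mulrA vw.
Qed.

Lemma ker_quot_mx a b (M : 'M[A]_(a, b)) :
  map_mx pi M = 0 -> exists V : 'M_(a, b), M = V *m f%:M.
Proof.
move=> M0; have /fin_all_exists[V MV] (i : 'I_a) : exists V : 'rV[A]_b,
    forall j, M i j = V 0 j * f.
  have /fin_all_exists[v Mv] (j : 'I_b) : exists v, M i j = v * f.
    by apply/ker_quot; move/matrixP/(_ i j): M0; rewrite !mxE.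
  by exists (\row_j v j) => j; rewrite mxE.
by exists (\matrix_i V i); apply/matrixP => i j; rewrite mul_mx_scalarE !mxE MV.
Qed.

Lemma quot_mx_f a b (V : 'M[A]_(a, b)) : map_mx pi (V *m f%:M) = 0.
Proof. by apply/matrixP => i j; rewrite mxE mul_mx_scalarE mxE rmorphM /= pi_f mulr0. Qed.

Lemma quot_mx_surj a b (M : 'M[B]_(a, b)) : exists M', M = map_mx pi M'.
Proof.
have [piS _] := B_quot.
have /fin_all_exists[V MV] (i : 'I_a) : exists V : 'rV[A]_b, forall j, M i j = pi (V 0 j).
  have /fin_all_exists[v Mv] (j : 'I_b) : exists v, M i j = pi v.
    by have [v <-] := piS (M i j); exists v.
  by exists (\row_j v j) => j; rewrite mxE.
by exists (\matrix_i V i); apply/matrixP => i j; rewrite !mxE MV.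
Qed.

Lemma regular_mx a b (V : 'M[A]_(a, b)) : V *m f%:M = 0 -> V = 0.
Proof.
move=> Vf; apply/matrixP => i j; rewrite [RHS]mxE; apply: f_regular; left.
by rewrite -mul_mx_scalarE Vf mxE.
Qed.

Lemma mx_over_deg2 a b c (M : 'M_(a, b)) (N : 'M_(b, c)) i j :
  gA 2%N ((mx_over x M *m mx_over x N) i j).
Proof.
rewrite mxE; apply: (grading_sum grA) => t; rewrite !mxE.
by apply: (cg_mul cgA (i := 1%N) (j := 1%N)); apply: lform_deg1.
Qed.

Definition scalar_mx_over (C : algType k) a b (M : 'M[k]_(a, b)) : 'M[C]_(a, b) :=
  map_mx (in_alg C) M.

(** Compare components of degree two: the entries of [mx_over x D] have degree one and [f] has
    degree two, so only the degree-one part of [W] and the degree-zero part of [V] contribute. *)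
Lemma linear_lift a b c (D : 'M_(a, b)) (Y : 'M[A]_(a, c)) W V :
  (forall i j, gA 2%N (Y i j)) -> Y = mx_over x D *m W + V *m f%:M ->
  exists W', Y = mx_over x D *m mx_over x W' + map_mx (cp 0) V *m f%:M.
Proof.
move=> Y2 YE.
have [W' WE] := mx_over_surj (M := map_mx (cp 1) W) x_basis
  (fun i j => ltac:(by rewrite mxE; apply: component_in)).
exists W'; rewrite -WE; apply/matrixP => i j.
rewrite -[LHS](component_id grA (Y2 i j)) YE mxE componentD [RHS]mxE.
congr (_ + _); last first.
  by rewrite !mul_mx_scalarE (component_mulr cgA 0 _ f_deg2) mxE.
rewrite [in LHS]mxE component_sum [RHS]mxE; apply: eq_bigr => t _.
by rewrite [map_mx (cp 1) W t j]mxE [mx_over x D i t]mxE (component_mull cgA 1 _ (lform_deg1 _)).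
Qed.

(** * Homology of the reduced resolution *)

Variables (s : nat -> nat)
  (d : forall i, 'M['rV[k]_n]_(res_rank n s i, res_rank n s i.+1)).
Hypothesis d_res : right_linear_resolution gA x d.

Local Notation r := (res_rank n s).
Local Notation dA i := (mx_over x (d i)).
Local Notation dB i := (mx_over y (d i)).

Lemma dA_exact i m (Y : 'M[A]_(r i.+1, m)) :
  dA i *m Y = 0 <-> exists W, Y = dA i.+1 *m W.
Proof.
have [_ _ ex] := d_res.
have dd (W : 'M[A]_(r i.+2, m)) : dA i *m (dA i.+1 *m W) = 0.
  apply: col_ext => j; rewrite col0 !col_mulmx.
  by apply/ex; exists (col j W).
split=> [Y0|[W ->//]].
have /fin_all_exists[W YW] (j : 'I_m) : exists w, col j Y = dA i.+1 *m w.
  by apply/ex; rewrite -col_mulmx Y0 col0.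
exists (\matrix_(a, j) W j a 0); apply: col_ext => j.
rewrite YW col_mulmx; congr (_ *m _); apply/colP => a.
by rewrite !mxE.
Qed.

Lemma dA_dA i : dA i *m dA i.+1 = 0.
Proof. by apply/dA_exact; exists 1%:M; rewrite mulmx1. Qed.

Lemma dA0_image m (Y : 'M[A]_(1, m)) :
  (forall j, positive_part gA (Y 0 j)) <-> exists W, Y = dA 0 *m W.
Proof.
have [_ ex _] := d_res; split=> [Yp|[W -> j]]; last first.
  apply/ex; exists (col j W); rewrite -col_mulmx; apply/colP => i.
  by rewrite !mxE ord1.
have /fin_all_exists[W YW] (j : 'I_m) : exists w : 'cV_(r 1), const_mx (Y 0 j) = dA 0 *m w.
  exact/ex.
exists (\matrix_(a, j) W j a 0); apply/rowP => j.
have /colP/(_ 0) := YW j; rewrite mxE => ->.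
by rewrite !mxE; apply: eq_bigr => t _; rewrite !mxE.
Qed.

Lemma dB_dB i : dB i *m dB i.+1 = 0.
Proof. by rewrite !mx_over_quot -map_mxM dA_dA map_mx0. Qed.

(* If [d v = v' f], then [d v' = 0] because [f] is regular, so [v' = d u] and
   [v - u f] is a cycle over [A]. *)
Lemma dB_exact i m (Y : 'M[B]_(r i.+2, m)) :
  dB i.+1 *m Y = 0 -> exists W, Y = dB i.+2 *m W.
Proof.
have [Y' ->] := quot_mx_surj Y; rewrite mx_over_quot -map_mxM.
move=> /ker_quot_mx[V YV].
have /dA_exact[W VW] : dA i *m V = 0.
  by apply: regular_mx; rewrite -mulmxA -YV mulmxA dA_dA mul0mx.
have /dA_exact[Z YZ] : dA i.+1 *m (Y' - W *m f%:M) = 0.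
  by rewrite mulmxBr mulmxA -VW YV subrr.
exists (map_mx pi Z); rewrite mx_over_quot -map_mxM -YZ map_mxB quot_mx_f.
by rewrite subr0.
Qed.

(** Lifted to [A], the equation holds up to a multiple of [f]; this persists when [linear_lift]
    makes the solution linear, and reduction kills the error. *)
Lemma linear_lift_quot i a b (M : 'M_(r i, a)) (N : 'M_(a, b)) W :
  mx_over y M *m mx_over y N = dB i *m W ->
  exists W', mx_over y M *m mx_over y N = dB i *m mx_over y W'.
Proof.
have [W0 ->] := quot_mx_surj W; rewrite !mx_over_quot -!map_mxM => E.
have /ker_quot_mx[V YV] : map_mx pi (mx_over x M *m mx_over x N - dA i *m W0) = 0.
  by rewrite map_mxB E subrr.
have [|W' WC] := linear_lift (mx_over_deg2 M N) (D := d i) (W := W0) (V := V).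
  by rewrite -YV addrC subrK.
by exists W'; rewrite mx_over_quot -map_mxM WC map_mxD quot_mx_f addr0.
Qed.

Lemma quadratic_lift : exists F : 'M_(r 1, 1), dA 0 *m mx_over x F = f%:M.
Proof.
have [j|W fW] := (dA0_image (f%:M : 'M_1)).1.
  by rewrite ord1 mxE eqxx; apply/(positive_partP grA)/(component_other grA _ f_deg2).
have [||F ->] := @linear_lift _ _ _ (d 0) (f%:M : 'M_1) W 0.
- by move=> i j; rewrite !ord1 mxE eqxx.
- by rewrite mul0mx addr0.
exists F; have -> : map_mx (cp 0) (0 : 'M[A]_1) = 0.
  by apply/matrixP => i j; rewrite !mxE component0.
by rewrite mul0mx addr0.
Qed.

Variable F : 'M['rV[k]_n]_(r 1, 1).
Hypothesis F_lift : dA 0 *m mx_over x F = f%:M.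
Local Notation FB := (mx_over y F).

Lemma dB0_F : dB 0 *m FB = 0.
Proof.
rewrite !mx_over_quot -map_mxM F_lift; apply/matrixP => i j.
by rewrite !mxE raddfMn /= pi_f mul0rn.
Qed.

(** A lift [Y'] satisfies [dA 0 *m Y' = V f]. The constant part [C] of [V] is accounted for by [F],
    since [dA 0] sends [F] to [f]; the rest is [dA 0 *m W], and removing [W f] leaves a cycle over
    [A]. *)
Lemma dB0_cycles m (Y : 'M[B]_(r 1, m)) : dB 0 *m Y = 0 ->
  exists C W, Y = FB *m scalar_mx_over B C + dB 1 *m W.
Proof.
have [Y' ->] := quot_mx_surj Y; rewrite mx_over_quot -map_mxM.
move=> /ker_quot_mx[V YV].
have /fin_all_exists[c Vc] (j : 'I_m) : exists c, cp 0 (V 0 j) = c%:A.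
  by apply: (degree0P cgA); apply: component_in.
pose C := \row_j c j.
have [j|W VW] := (dA0_image (V - scalar_mx_over A C)).1.
  apply/(positive_partP grA); rewrite !mxE componentB Vc.
  by rewrite component_id ?subrr //; apply/(cg_degree0 cgA); exists (c j).
have Cf : scalar_mx_over A C *m f%:M = f%:M *m scalar_mx_over A C.
  apply/matrixP => i j; rewrite mul_mx_scalarE mul_scalar_mx !mxE.
  by rewrite mulr_algl mulr_algr.
have /dA_exact[Z YZ] :
    dA 0 *m (Y' - mx_over x F *m scalar_mx_over A C - W *m f%:M) = 0.
  by rewrite !mulmxBr !mulmxA F_lift YV -Cf -VW mulmxBl subrr.
exists C, (map_mx pi Z); rewrite mx_over_quot [dB 1]mx_over_quot.
have -> : scalar_mx_over B C = map_mx pi (scalar_mx_over A C).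
  by apply/matrixP => i j; rewrite !mxE linearZ /= rmorph1.
rewrite -!map_mxM -YZ map_mxB map_mxB quot_mx_f subr0.
by rewrite addrC subrK.
Qed.

(** Applying [dA 0] to a lift of the equation gives [f w' = (dA 0 V) f]. As [dA 0 V] has no constant
    part and [f] is regular, neither has [w']. With [F_dB0] and [dB0_cycles], the homology in degree
    one is the trivial module. *)
Lemma F_annihilator m (w : 'M[B]_(1, m)) W :
  FB *m w = dB 1 *m W -> exists W0, w = dB 0 *m W0.
Proof.
have [w' ->] := quot_mx_surj w; have [W' ->] := quot_mx_surj W.
rewrite !mx_over_quot -!map_mxM => E.
have /ker_quot_mx[V wV] :
    map_mx pi (mx_over x F *m w' - dA 1 *m W') = 0 by rewrite map_mxB E subrr.
have fw : f%:M *m w' = dA 0 *m V *m f%:M.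
  by rewrite -mulmxA -wV mulmxBr !mulmxA F_lift dA_dA mul0mx subr0.
have [j|W0 wW] := (dA0_image w').1; last first.
  by exists (map_mx pi W0); rewrite wW map_mxM.
apply/(positive_partP grA)/f_regular; right.
have := (dA0_image (dA 0 *m V)).2 (ex_intro _ V erefl) j.
move=> /(positive_partP grA) V0.
rewrite -(component_mull cgA 0 _ f_deg2) addn0.
have -> : f * w' 0 j = (f%:M *m w') 0 j by rewrite mul_scalar_mx mxE.
by rewrite fw mul_mx_scalarE (component_mulr cgA 0 _ f_deg2) V0 mul0r.
Qed.

(** Normality gives [f x_j = V_j f], where [V] has no constant part since [f x_j] has degree three.
    So [V = dA 0 W], and [F dA 0 - W f] is a cycle over [A]: each [x_j] kills the class of [F]. *)
Lemma F_dB0 : exists E, FB *m dB 0 = dB 1 *m mx_over y E.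
Proof.
have [V fV] : exists V, f%:M *m dA 0 = V *m f%:M.
  apply: ker_quot_mx; apply/matrixP => i j; rewrite mul_scalar_mx !mxE.
  by rewrite rmorphM /= pi_f mul0r.
have [j|W VW] := (dA0_image V).1.
  apply/(positive_partP grA)/f_regular; left.
  rewrite -(component_mulr cgA 0 _ f_deg2) -mul_mx_scalarE -fV.
  rewrite mul_scalar_mx !mxE; apply: (component_other grA (i := 3%N)) => //.
  by apply: (cg_mul cgA (i := 2%N) (j := 1%N) f_deg2); apply: lform_deg1.
have /dA_exact[Z FZ] : dA 0 *m (mx_over x F *m dA 0 - W *m f%:M) = 0.
  by rewrite mulmxBr !mulmxA F_lift -VW fV subrr.
apply: (linear_lift_quot (W := map_mx pi Z)).
by rewrite !mx_over_quot -!map_mxM -FZ map_mxB quot_mx_f subr0.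
Qed.

(** The cone takes a total function, while a solution exists only if the product is a boundary;
    otherwise the value is arbitrary. The sign sits in the lift, so the blocks of the cone carry
    none. *)
Definition lift_choice i a b (E : 'M['rV[k]_n]_(r i, a)) (G : 'M['rV[k]_n]_(a, b)) :
    'M['rV[k]_n]_(r i.+1, b) :=
  epsilon (inhabits 0) (fun X => mx_over y E *m mx_over y G + dB i *m mx_over y X = 0).

Lemma lift_choiceP i a b (E : 'M['rV[k]_n]_(r i, a)) (G : 'M['rV[k]_n]_(a, b)) :
  (exists W, mx_over y E *m mx_over y G = dB i *m W) ->
  mx_over y E *m mx_over y G + dB i *m mx_over y (lift_choice E G) = 0.
Proof.
move=> [W EW]; rewrite /lift_choice.
apply: (epsilon_spec (inhabits (0 : 'M['rV[k]_n]_(r i.+1, b)))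
  (fun X => mx_over y E *m mx_over y G + dB i *m mx_over y X = 0)).
have [X ->] := linear_lift_quot EW.
by exists (- X); rewrite mx_overN mulmxN subrr.
Qed.

(** * Exactness of the cone *)

Local Notation U := (cone_rank n s).
Local Notation G := (cone_diff d F lift_choice).
Local Notation E := (cone_homotopy d F lift_choice).
Local Notation GB j := (mx_over y (G j)).
Local Notation EB j := (mx_over y (E j)).

(** The identities are proved together: the homotopy identity is the lower left block of the next
    product, and that product being zero makes [EB j.+1 *m GB j.+2] a cycle, which allows the next
    lift. *)
Lemma cone_complex j : [/\ GB j *m GB j.+1 = 0, GB j.+1 *m GB j.+2 = 0
  & EB j *m GB j.+1 + dB j *m EB j.+1 = 0].
Proof.
elim: j => [|j [GG0 GG1 EG]].
  split; first exact: flatmx0; first exact: flatmx0.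
  by rewrite [EB 0]thinmx0 mul0mx add0r; apply: dB0_F.
have EG' : EB j.+1 *m GB j.+2 + dB j.+1 *m EB j.+2 = 0.
  rewrite cone_homotopySS; apply: lift_choiceP.
  (* At [j = 0] the product lies in degree one, where homology survives; [F_dB0] takes the place of
     [dB_exact]. *)
  case: j GG0 GG1 EG => [|j] GG0 GG1 EG.
    rewrite cone_diff2; have [X FX] := F_dB0; exists (mx_over y X); exact: FX.
  apply: dB_exact.
  move/eqP: EG; rewrite addrC addr_eq0 mulmxA => /eqP->.
  by rewrite mulNmx -mulmxA GG1 mulmx0 oppr0.
split=> //; rewrite !cone_diffSS !mx_over_block mulmx_block !mx_over0.
rewrite !mul0mx !mulmx0 !addr0 !add0r GG0 EG dB_dB.
exact: block_mx0.
Qed.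

Lemma cone_diff_col j (u : 'cV[B]_(U j.+1)) (v : 'cV[B]_(r j.+1)) :
  GB j.+2 *m col_mx u v = col_mx (GB j *m u) (EB j *m u + dB j *m v).
Proof. by rewrite cone_diffSS mx_over_block mx_over0 mul_block_col mul0mx addr0. Qed.

(** Split [v] into [u] in the shifted copy and [v1]. Two indices lower, [u] is a boundary with
    preimage [u']; then [v1] minus the homotopy applied to [u'] is a cycle of the reduced
    resolution, where [dB_exact] applies. The two lowest indices use the homology in degree one. *)
Lemma cone_exact j (v : 'cV[B]_(U j.+3)) :
  GB j.+2 *m v = 0 -> exists w, v = GB j.+3 *m w.
Proof.
have step i (u : 'cV[B]_(U i.+2)) (v1 : 'cV[B]_(r i.+2)) :
    (exists u', u = GB i.+2 *m u') -> EB i.+1 *m u + dB i.+1 *m v1 = 0 ->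
    exists w, col_mx u v1 = GB i.+4 *m w.
  move=> [u' ->] EG; have [_ _ EGE] := cone_complex i.+1.
  have [|v' vE] := @dB_exact i _ (v1 - EB i.+2 *m u').
    move/eqP: EGE; rewrite addr_eq0 => /eqP EGE.
    by rewrite mulmxBr mulmxA -[dB _ *m EB _]opprK -EGE mulNmx opprK addrC -mulmxA.
  by exists (col_mx u' v'); rewrite (@cone_diff_col i.+2) -vE addrC subrK.
have [m] := ubnP j; elim: m j v => // m IHm j v; rewrite ltnS => jm.
rewrite -[v]vsubmxK cone_diff_col; move/eqP; rewrite col_mx_eq0 => /andP[/eqP Gu /eqP EG].
case: j v jm Gu EG => [|j] v jm Gu EG.
  (* The shifted part is empty; a multiple of the class of [F] is absorbed by the first generator of
     the shifted copy, which the cone sends to [F]. *)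
  have [|C [W vE]] := @dB0_cycles _ (dsubmx v).
    by rewrite -EG [usubmx v]flatmx0 mulmx0 add0r.
  exists (col_mx (scalar_mx_over B C) W).
  rewrite (@cone_diff_col 1) vE.
  by congr col_mx; apply: etrans (flatmx0 _) (esym (flatmx0 _)).
apply: step => //; case: j v jm Gu EG => [|j] v jm Gu EG; last first.
  by apply: (IHm j) => //; apply: ltn_trans jm.
(* Here [u] is a coefficient of [F] making it a boundary, so it lies in the image of [dB 0]. *)
have [|W0 uE] := @F_annihilator _ (usubmx v) (- dsubmx v).
  by rewrite mulmxN; apply/eqP; rewrite -addr_eq0 EG.
by exists W0; rewrite cone_diff2.
Qed.

(** Two shifts add up: [res_rank] sets the first two ranks apart, and the cone indices are two
    higher. Likewise [quot_diff i] is [G i.+2] throughout, its cases serving to make the types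
    compute. *)
Definition quot_ranks j : nat := U j.+4.

Definition quot_diff i :
    'M['rV[k]_n]_(res_rank n quot_ranks i, res_rank n quot_ranks i.+1) :=
  match i with 0 => G 2 | 1 => G 3 | j.+2 => G j.+4 end.

Lemma positive_part_quot b : positive_part (image_grading pi gA) b <->
  exists2 a, positive_part gA a & b = pi a.
Proof.
split=> [[N [c [gc ->]]]|[a [N [c [gc ->]]] ->]]; last first.
  exists N, (pi \o c); rewrite raddf_sum; split=> // i.
  by exists (c i).
elim/big_ind: _ => [|b1 b2 [a1 Pa1 ->] [a2 Pa2 ->]|i _].
- by exists 0; rewrite ?raddf0 //; apply/(positive_partP grA)/component0.
- exists (a1 + a2); last by rewrite raddfD.
  by apply/(positive_partP grA); rewrite componentD !(positive_partP grA _).1 ?addr0.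
by have [a ga ->] := gc i; exists a => //; apply/(positive_partP grA)/(component_other grA _ ga).
Qed.

Lemma quot_resolution :
  right_linear_resolution (image_grading pi gA) y quot_diff.
Proof.
have [d0E _ _] := d_res.
split=> [|b|i v].
- by rewrite -d0E; apply: cone_diff2.
- rewrite positive_part_quot [quot_diff 0]cone_diff2; split=> [[a Pa ->]|[w bE]].
    have [j|W aW] := (dA0_image (a%:M : 'M_1)).1; first by rewrite !ord1 mxE.
    exists (map_mx pi W); rewrite mx_over_quot -map_mxM -aW.
    by apply/matrixP => i j; rewrite !ord1 !mxE.
  have [w' wE] := quot_mx_surj w.
  exists ((dA 0 *m w') 0 0); last first.
    by move/matrixP/(_ 0 0): bE; rewrite mxE wE mx_over_quot -map_mxM [RHS]mxE.
  by apply: (dA0_image (dA 0 *m w')).2; exists w'.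
split=> [|[w ->]].
  by move: v; case: i => [|[|i]] v;
    [exact: (@cone_exact 0) | exact: (@cone_exact 1) | exact: (@cone_exact i.+2)].
have GG j : GB j.+2 *m GB j.+3 = 0 by have [_ ? _] := cone_complex j.+1.
have -> : mx_over y (quot_diff i) *m (mx_over y (quot_diff i.+1) *m w) =
          mx_over y (quot_diff i) *m mx_over y (quot_diff i.+1) *m w by rewrite mulmxA.
have -> : mx_over y (quot_diff i) *m mx_over y (quot_diff i.+1) = 0.
  by case: i v w => [|[|i]] _ _;
    [exact: (GG 0%N) | exact: (GG 1%N) | exact: (GG i.+2)].
exact: mul0mx.
Qed.

(** * Relations, points and ranks over the quotient *)

Lemma relation_quot g : relation x g -> relation y g.
Proof.
rewrite /relation => Rg.
transitivity (pi (\sum_i \sum_j g i j *: (x i * x j))); last by rewrite Rg raddf0.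
rewrite linear_sum; apply: eq_bigr => i _; rewrite linear_sum; apply: eq_bigr => j _.
by rewrite linearZ /= rmorphM.
Qed.

Lemma relation_zeros_quot p q : relation_zeros y p q -> relation_zeros x p q.
Proof. by case=> p0 q0 Z; split=> // g /relation_quot/Z. Qed.

Lemma right_points_quot p : right_points y p -> right_points x p.
Proof.
move/right_pointsP => [o RZ]; apply/right_pointsP; exists o.
exact: relation_zeros_quot.
Qed.

Lemma quot_point_exact l :
  (forall q, right_points y q -> exists2 o, right_points y o & relation_zeros y o q) ->
  (forall i, (i < l)%N -> right_point_exact_atS x d i) ->
  forall i, (i < l)%N -> right_point_exact_atS y quot_diff i.
Proof.
move=> pred exA.
have rank_d0 p : right_points x p -> \rank (mx_at p (d 0)) = 1%N.
  case=> p0 _; have [-> _ _] := d_res; rewrite mx_at_coords.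
  by rewrite rank_rV p0.
have rankG2 p : right_points x p -> \rank (mx_at p (G 2)) = 1%N.
  by move=> Xp; rewrite cone_diff2; apply: rank_d0.
(* The diagonal blocks from the shifted copy are treated two indices lower, those from [A] by its
   point-exactness. Index [j.+2] uses [exA j], so the bound [l.+1] matches [j < l]. *)
have sum_ge j p : (j <= l.+1)%N -> right_points y p ->
    (U j.+1 <= \rank (mx_at p (G j)) + \rank (mx_at p (G j.+1)))%N.
  move=> jl Xp; have Xp' := right_points_quot Xp.
  have [m] := ubnP j; elim: m j jl => // m IHm [|[|j]] jl; rewrite ltnS => jm //.
    by rewrite rankG2 // leq_addl.
  apply: (@leq_trans (U j.+1 + (\rank (mx_at p (d j)) + \rank (mx_at p (d j.+1))))).
    by rewrite (exA j jl p Xp').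
  have := leq_add (rank_block_lower (mx_at p (G j)) (mx_at p (E j)) (mx_at p (d j)))
    (rank_block_lower (mx_at p (G j.+1)) (mx_at p (E j.+1)) (mx_at p (d j.+1))).
  rewrite -!(mx_at0 p) -!mx_at_block -!cone_diffSS; apply: leq_trans.
  by rewrite addnACA leq_add2r; apply: (IHm j (ltnW (ltnW jl)) (ltnW jm)).
(* Constancy and equality alternate: a constant rank yields the sum, and the sum yields the next
   rank, again constant. The start is [G 2], of rank one. *)
have rank_const j : (j <= l)%N ->
    (exists c, forall p, right_points y p -> \rank (mx_at p (G j.+2)) = c) /\
    ((j < l)%N -> forall p, right_points y p ->
      (\rank (mx_at p (G j.+2)) + \rank (mx_at p (G j.+3)))%N = U j.+3).
  have sum_eq i c : (i < l)%N ->
      (forall p, right_points y p -> \rank (mx_at p (G i.+2)) = c) ->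
      forall p, right_points y p ->
        (\rank (mx_at p (G i.+2)) + \rank (mx_at p (G i.+3)))%N = U i.+3.
    move=> il cE p Xp; apply/eqP; rewrite eqn_leq sum_ge // andbT.
    (* Constancy lets the first rank be read at a predecessor [o] of [p]; the product vanishing at
       [(o, p)] then bounds the sum from above. *)
    have [o Xo RZ] := pred p Xp; rewrite (cE p) // -(cE o) //.
    have GG : GB i.+2 *m GB i.+3 = 0 by have [_ ? _] := cone_complex i.+1.
    exact/mulmx0_rank_max/(mx_at_product0 RZ GG).
  elim: j => [|j IHj] jl.
    have c1 p : right_points y p -> \rank (mx_at p (G 2)) = 1%N.
      by move/right_points_quot; apply: rankG2.
    by split=> [|l0]; [exists 1%N | apply: (sum_eq 0 1)].
  have [[c cE] /(_ jl) cS] := IHj (ltnW jl).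
  have cE' p : right_points y p -> \rank (mx_at p (G j.+3)) = (U j.+3 - c)%N.
    by move=> Xp; apply/eqP; rewrite -(eqn_add2l c) -{1}(cE p Xp) (cS p Xp) subnKC //
      -(cS p Xp) (cE p Xp) leq_addr.
  by split=> [|jl']; [exists (U j.+3 - c)%N | apply: (sum_eq _ _ jl' cE')].
move=> i il p Xp; have [_ /(_ il p Xp)] := rank_const i (ltnW il).
by case: i il => [|[|i]].
Qed.

(** The form [P] represents [f] and has value [p *m mx_at q F]. A relation [g] of [B] maps to [w f]
    in degree two, so to [c f] with [c] the constant part of [w], and [g - c P] is a relation of
    [A]. *)
Lemma relation_zeros_quotP p q :
  relation_zeros y p q <-> relation_zeros x p q /\ p *m mx_at q F = 0.
Proof.
have [d0E _ _] := d_res.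
split=> [RZ|[[p0 q0 Z] Fpq]].
  split; first exact: relation_zeros_quot.
  by have := mx_at_product0 RZ dB0_F; rewrite d0E mx_at_coords.
split=> // g Rg.
have [w wE] : exists w, \sum_i \sum_j g i j *: (x i * x j) = w * f.
  apply/ker_quot; rewrite linear_sum -[RHS]Rg; apply: eq_bigr => i _.
  by rewrite linear_sum; apply: eq_bigr => j _; rewrite linearZ /= rmorphM.
have [c cE] : exists c, cp 0 w = c%:A.
  by apply: (degree0P cgA); apply: component_in.
pose P := product_coeffs (d 0) F 0 0.
have PE : \sum_i \sum_j P i j *: (x i * x j) = f.
  by rewrite -mx_over_mul F_lift mxE eqxx.
have gE : \sum_i \sum_j g i j *: (x i * x j) = c *: f.
  rewrite -mulr_algl -cE -(component_mulr cgA 0 _ f_deg2) -wE component_id //.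
  have x1 i : gA 1%N (x i) by rewrite -lform_delta; apply: lform_deg1.
  apply: (grading_sum grA) => i; apply: (grading_sum grA) => j.
  apply: (gradingZ cgA); exact: (cg_mul cgA (i := 1%N) (j := 1%N)).
have /Z gP : relation x ((- c) *: P + g).
  by rewrite /relation quadratic_sum_linear PE gE scaleNr addNr.
have FP : \sum_i \sum_j P i j * (p 0 i * q 0 j) = 0.
  by rewrite -mx_at_mul d0E mx_at_coords Fpq mxE.
move: gP FP; rewrite !bilinear_mulmx mulmxDr mulmxDl -scalemxAr -scalemxAl !mxE => gP FP.
by move: gP; rewrite FP mulr0 add0r.
Qed.

(* The relation [f v = w f] in [A_3] is evaluated at [(p, q, u)]. *)
Lemma normal_transport p q u v w : relation_zeros x p q -> relation_zeros x q u ->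
  f * lform x v = lform x w * f ->
  (u *m v^T) 0 0 *: (p *m mx_at q F) = (p *m w^T) 0 0 *: (q *m mx_at u F).
Proof.
move=> RZpq RZqu fv; have [d0E _ _] := d_res.
pose V : 'M['rV[k]_n]_1 := const_mx v.
(* With entries [w_i x_j], so that [dA 0] times [N] times [F] factors [w f] into linear matrices. *)
pose N : 'M['rV[k]_n]_(r 1, r 1) := \matrix_(i, j) (w 0 i *: delta_mx 0 j).
have NE i j : mx_over x N i j = w 0 i *: x j.
  by rewrite !mxE linearZ /= lform_delta.
have xE i : dA 0 0 i = x i by rewrite d0E !mxE lform_delta.
have NF i : (mx_over x N *m mx_over x F) i 0 = w 0 i *: f.
  have <- : (dA 0 *m mx_over x F) 0 0 = f by rewrite F_lift mxE eqxx.
  rewrite mxE [in RHS]mxE scaler_sumr; apply: eq_bigr => j _.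
  by rewrite NE xE -scalerAl.
have dNF : (dA 0 *m (mx_over x N *m mx_over x F)) 0 0 = lform x w * f.
  rewrite mxE /lform mulr_suml; apply: eq_bigr => i _.
  by rewrite xE NF -scalerAr scalerAl.
(* [dA 0] sends the two terms to [f v] and [w f]. The resulting preimage under [dA 1] can be taken
   linear because the difference has degree two. *)
have cycle : dA 0 *m (mx_over x F *m mx_over x V - mx_over x N *m mx_over x F) = 0.
  rewrite mulmxBr [dA 0 *m (_ *m mx_over x V)]mulmxA F_lift; apply/matrixP => i j.
  rewrite !ord1 mul_scalar_mx [LHS]mxE [X in _ + X]mxE dNF [RHS]mxE.
  by rewrite [X in X - _]mxE mxE mxE fv subrr.
have /dA_exact[W WE] := cycle.
have [||X XE] := @linear_lift _ _ _ (d 1) _ W 0 _ (etrans WE (esym _)).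
- move=> i j; rewrite mxE [X in _ + X]mxE.
  by apply: (gradingB grA); apply: mx_over_deg2.
- by rewrite mul0mx addr0.
have XE' : mx_over x F *m mx_over x V - mx_over x N *m mx_over x F = dA 1 *m mx_over x X.
  rewrite XE; have -> : map_mx (cp 0) (0 : 'M[A]_(r 1, 1)) = 0.
    by apply/matrixP => i j; rewrite !mxE component0.
  by rewrite mul0mx addr0.
(* The whole identity becomes one product of linear matrices, evaluated at [(q, u)]. Multiplying by
   [p] on the left kills the [d 1] term, since [(p, q)] is a zero. *)
have : mx_over x (row_mx F (row_mx (- N) (- d 1))) *m
       mx_over x (col_mx V (col_mx F X)) = 0.
  rewrite !mx_over_row !mx_over_col !mul_row_col !mx_overN !mulNmx addrA XE'.
  by rewrite subrr.
move/(mx_at_product0 RZqu); rewrite !mx_at_row !mx_at_col !mul_row_col.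
move/(congr1 (mulmx p)); rewrite !mulmxDr mulmx0 !mx_atN !mulNmx !mulmxN.
have -> : p *m (mx_at q (d 1) *m mx_at u X) = 0.
  have := mx_at_product0 RZpq (dA_dA 0); rewrite d0E mx_at_coords mulmxA => ->.
  by rewrite mul0mx.
rewrite subr0 => /eqP; rewrite subr_eq0 !mulmxA => /eqP.
have -> : mx_at u V = (u *m v^T) 0 0 *: 1%:M.
  apply/matrixP => i j; rewrite !ord1 !mxE eqxx mulr1; apply: eq_bigr => t _.
  by rewrite !mxE mulrC.
have -> : p *m mx_at q N = (p *m w^T) 0 0 *: q.
  have -> : mx_at q N = w^T *m q.
    apply/matrixP => i j; rewrite !mxE big_ord_recl big_ord0 addr0 !mxE.
    rewrite (bigD1 j) //= big1 ?addr0 => [|t tj]; rewrite !mxE ?eqxx ?mulr1 //.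
    by rewrite (negPf tj) andbF mulr0 mul0r.
  by rewrite mulmxA [p *m _]mx11_scalar mul_scalar_mx; congr (_ *: _); rewrite [RHS]mxE.
by rewrite -scalemxAr mulmx1 -scalemxAl.
Qed.

Lemma normal_commute v : exists w, f * lform x v = lform x w * f.
Proof.
have [a aE] : exists a, f * lform x v = a * f by apply/f_normal; exists (lform x v).
have [w wE] := deg1_lform (component_in grA 1 a).
exists w; rewrite aE -wE -(component_mulr cgA 1 _ f_deg2) -aE component_id //.
exact: (cg_mul cgA (i := 2%N) (j := 1%N) f_deg2 (lform_deg1 v)).
Qed.

Lemma normal_commute_sym w : exists v, f * lform x v = lform x w * f.
Proof.
have [a aE] : exists a, lform x w * f = f * a by apply/f_normal; exists (lform x w).
have [v vE] := deg1_lform (component_in grA 1 a).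
exists v; rewrite aE -vE -(component_mull cgA 1 _ f_deg2) -aE component_id //.
exact: (cg_mul cgA (i := 1%N) (j := 2%N) (lform_deg1 w) f_deg2).
Qed.

Lemma nonzero_coordinate (p : 'rV[k]_n) : p != 0 -> exists v : 'rV_n, (p *m v^T) 0 0 != 0.
Proof.
case/rV0Pn => i pi0; exists (delta_mx 0 i); rewrite mxE (bigD1 i) //= big1.
  by rewrite !mxE !eqxx mulr1 addr0.
by move=> j ji; rewrite !mxE (negPf ji) andbF mulr0.
Qed.

(** Only the conditions on [F] differ. In [normal_transport], take [w] nonzero at [p] for one
    implication and [v] nonzero at [u] for the other; normality provides the partner either way. *)
Lemma relation_zeros_shift p q u : relation_zeros x p q -> relation_zeros x q u ->
  relation_zeros y p q <-> relation_zeros y q u.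
Proof.
move=> RZpq RZqu; rewrite !relation_zeros_quotP.
have [p0 _ _] := RZpq; have [_ u0 _] := RZqu.
split=> -[_ F0]; split=> //.
  have [w pw] := nonzero_coordinate p0; have [v fv] := normal_commute_sym w.
  have := normal_transport RZpq RZqu fv; rewrite F0 scaler0 => /esym/eqP.
  by rewrite scaler_eq0 (negPf pw) => /eqP.
have [v uv] := nonzero_coordinate u0; have [w fv] := normal_commute v.
have := normal_transport RZpq RZqu fv; rewrite F0 scaler0 => /eqP.
by rewrite scaler_eq0 (negPf uv) => /eqP.
Qed.

End Quotient.

(** * The condition (G1) *)

Section G1Facts.
Variables (k : fieldType) (n : nat) (A : algType k) (x : 'I_n -> A).

Lemma same_point_sym (p q : 'rV[k]_n) : same_point p q -> same_point q p.
Proof.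
by case=> c c0 ->; exists c^-1; rewrite ?invr_eq0 // scalerA mulVf // scale1r.
Qed.

Lemma relation_zeros_same p q p' q' : same_point p p' -> same_point q q' ->
  relation_zeros x p q -> relation_zeros x p' q'.
Proof.
case=> c c0 -> [e e0 ->] [p0 q0 Z]; split; rewrite ?scaler_eq0 ?negb_or ?c0 ?e0 //.
move=> g /Z; rewrite !bilinear_mulmx linearZ -!scalemxAl -scalemxAr !mxE => ->.
by rewrite !mulr0.
Qed.

Lemma G1_next : G1 x -> forall p q, relation_zeros x p q -> exists u, relation_zeros x q u.
Proof.
case=> E [sigma [_ [[sE _] _] RE]] p q /RE[Ep spq].
have RZ : relation_zeros x (sigma p) (sigma (sigma p)).
  by apply/RE; split; [apply: sE | exists 1; rewrite ?oner_eq0 ?scale1r].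
by exists (sigma (sigma p)); apply: relation_zeros_same RZ => //; exists 1;
  rewrite ?oner_eq0 ?scale1r.
Qed.

Lemma G1_prev : G1 x -> forall p q, relation_zeros x p q -> exists o, relation_zeros x o p.
Proof.
case=> E [sigma [_ [_ [tau [tE _] st]] RE]] p q /RE[Ep _].
exists (tau p); apply/RE; split; first exact: tE.
by apply: same_point_sym; have [] := st p Ep.
Qed.

End G1Facts.

(** * The left points as a determinantal locus *)

Section LeftPointsClosed.
Variables (k : fieldType) (n : nat).

Lemma dhomog_prod_linear (I : Type) (s : seq I) (F : I -> {mpoly k[n]}) :
  (forall i, F i \is 1.-homog) -> \prod_(i <- s) F i \is (size s).-homog.
Proof.
move=> F1; elim: s => [|i s IHs]; first by rewrite big_nil dhomog1.
by rewrite big_cons /= -add1n; apply: dhomogM.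
Qed.

Lemma dhomog_det m (M : 'M[{mpoly k[n]}]_m) :
  (forall i j, M i j \is 1.-homog) -> \det M \is m.-homog.
Proof.
move=> M1; apply: rpred_sum => s _; rewrite mulr_sign.
have Hs : \prod_i M i (s i) \is m.-homog.
  by rewrite -[m in m.-homog]card_ord cardE; rewrite enumT; apply: dhomog_prod_linear.
by case: ifP => // _; rewrite rpredN.
Qed.

Definition linear_mpoly (v : 'rV[k]_n) : {mpoly k[n]} := \sum_t v 0 t *: 'X_t.

Lemma linear_mpoly_homog v : linear_mpoly v \is 1.-homog.
Proof. by apply: rpred_sum => t _; apply: dhomogZ; rewrite dhomogX /= mdeg1. Qed.

Lemma mpoly_at_linear v p : mpoly_at (linear_mpoly v) p = \sum_t v 0 t * p 0 t.
Proof.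
by rewrite /mpoly_at raddf_sum; apply: eq_bigr => t _; rewrite /= mevalZ mevalXU.
Qed.

Lemma mpoly_at_det m (M : 'M['rV[k]_n]_m) p :
  mpoly_at (\det (map_mx linear_mpoly M)) p = \det (mx_at p M).
Proof.
rewrite /mpoly_at -det_map_mx; congr (\det _).
by apply/matrixP => i j; rewrite !mxE; apply: mpoly_at_linear.
Qed.

(** Maps [phi] with repeated values only add zero determinants; full column rank gives an invertible
    choice of [n] rows. *)
Lemma rank_lt_minors r (M : 'M[k]_(r, n)) :
  (\rank M < n)%N <-> forall phi : 'I_n -> 'I_r, \det (rowsub phi M) = 0.
Proof.
split=> [rM phi|minors].
  apply/eqP; rewrite -[_ == 0]negbK -unitfE -[_ \is a _]/(_ \in unitmx) -row_full_unit.
  rewrite /row_full neq_ltn (leq_ltn_trans _ rM) //.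
  apply: mxrankS; apply/row_subP => i; rewrite row_rowsub; exact: row_sub.
rewrite ltn_neqAle rank_leq_col andbT; apply/negP => fullM.
have := fullrowsub_unit fullM; rewrite unitmxE minors unitfE eqxx //.
Qed.

Lemma left_points_closed (A : algType k) (x : 'I_n -> A) : closed_subset (left_points x).
Proof.
have [r [F BF]] := relation_basis_exists x.
exists (fun g => exists phi : 'I_n -> 'I_r,
  g = \det (map_mx linear_mpoly (rowsub phi (left_relation_mx F)))).
split=> [g [phi ->]|p].
  by exists n; apply: dhomog_det => i j; rewrite mxE; apply: linear_mpoly_homog.
have E : left_points x p <-> p != 0 /\ (\rank (mx_at p (left_relation_mx F)) < n)%N.
  split=> [/left_pointsP[q RZ]|[p0 rk]]; last by split=> //; exists r, F.
  have [p0 q0 Z] := (relation_zerosE p q BF).1 RZ; split=> //.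
  by rewrite left_relation_at; apply/rank_ltP; exists q => // i; rewrite rowK.
rewrite E; split=> -[p0 H]; split=> //.
  move=> g [phi ->]; rewrite mpoly_at_det.
  have <- := (rank_lt_minors _).1 H phi; congr (\det _).
  by apply/matrixP => i j; rewrite !mxE.
apply/rank_lt_minors => phi.
rewrite -[RHS](H _ (ex_intro _ phi erefl)) mpoly_at_det; congr (\det _).
by apply/matrixP => i j; rewrite !mxE.
Qed.

End LeftPointsClosed.

(** The variety is [left_points y], with [sigma] and [tau] restricted. The shift hypothesis
    preserves it under [sigma] in one direction and, at [(tau p, p, sigma p)], under [tau] in the
    other. *)
Lemma G1_restrict (k : fieldType) (n : nat) (A B : algType k) (x : 'I_n -> A) (y : 'I_n -> B) :
  (forall p q, relation_zeros y p q -> relation_zeros x p q) ->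
  (forall p q u, relation_zeros x p q -> relation_zeros x q u ->
    relation_zeros y p q <-> relation_zeros y q u) ->
  G1 x -> G1 y.
Proof.
move=> sub shift G1x; have next := G1_next G1x.
have [E [sigma [_ [[sE smor] [tau [tE tmor] st]] RE]]] := G1x.
have refl (p : 'rV[k]_n) : same_point p p by exists 1; rewrite ?oner_eq0 ?scale1r.
have EB p : left_points y p -> E p /\ relation_zeros y p (sigma p).
  move/left_pointsP => [q RZ]; have /RE[Ep spq] := sub _ _ RZ; split=> //.
  exact: relation_zeros_same (refl p) (same_point_sym spq) RZ.
have sB p : left_points y p -> left_points y (sigma p).
  move/EB => [Ep RZ]; have [u RZu] := next _ _ (sub _ _ RZ).
  by apply/left_pointsP; exists u; apply: (shift _ _ _ (sub _ _ RZ) RZu).1.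
have tB p : left_points y p -> left_points y (tau p).
  move=> Bp; have [Ep RZ] := EB p Bp; have [_ stp] := st p Ep.
  have RZt : relation_zeros x (tau p) p.
    by apply/RE; split; [apply: tE | apply: same_point_sym].
  by apply/left_pointsP; exists p; apply/(shift _ _ _ RZt (sub _ _ RZ)).
exists (left_points y), sigma; split; first exact: left_points_closed.
- split; [|exists tau]; last by move=> p /EB[Ep _]; apply: st.
    split=> // p /EB[Ep _]; have [d [phi [? ? H]]] := smor p Ep.
    by exists d, phi; split=> // q /EB[Eq _]; apply: H.
  split=> // p /EB[Ep _]; have [d [phi [? ? H]]] := tmor p Ep.
  by exists d, phi; split=> // q /EB[Eq _]; apply: H.
- move=> p q; split=> [RZ|[/EB[Ep RZ] spq]].
    by split; [apply/left_pointsP; exists q | have /RE[] := sub _ _ RZ].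
  exact: relation_zeros_same (refl p) spq RZ.
Qed.

(** * The converse algebra *)

Section ConverseAlgebra.
Variables (k : fieldType) (A : algType k).

HB.instance Definition _ := GRing.LSemiModule.copy A^c A.

Fact converse_scaleAl (c : k) (a b : A^c) : c *: (a * b) = (c *: a : A^c) * b.
Proof. exact: (@scalerAr k A c b a). Qed.
HB.instance Definition _ :=
  GRing.LSemiModule_isLSemiAlgebra.Build k A^c converse_scaleAl.

Fact converse_scaleAr (c : k) (a b : A^c) : c *: (a * b) = a * (c *: b : A^c).
Proof. exact: (@scalerAl k A c b a). Qed.
HB.instance Definition _ :=
  GRing.LSemiAlgebra_isSemiAlgebra.Build k A^c converse_scaleAr.
End ConverseAlgebra.

Section ConverseMorphism.
Variables (k : fieldType) (A B : algType k) (pi : {lrmorphism A -> B}).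

Definition converse_morphism (a : A^c) : B^c := pi a.

Fact converse_morphism_linear : linear converse_morphism.
Proof. exact: linearP pi. Qed.
HB.instance Definition _ := GRing.isLinear.Build k A^c B^c _ converse_morphism
  converse_morphism_linear.

Fact converse_morphism_monoid : monoid_morphism converse_morphism.
Proof. split; [exact: rmorph1 pi | by move=> a b; apply: (rmorphM pi)]. Qed.
HB.instance Definition _ := GRing.isMonoidMorphism.Build A^c B^c converse_morphism
  converse_morphism_monoid.
End ConverseMorphism.

Section ConverseTransfer.
Variables (k : fieldType) (A : algType k) (gA : nat -> A -> Prop) (n : nat).
Variable x : 'I_n -> A.

Lemma converse_connected_graded :
  connected_graded gA -> @connected_graded k A^c gA.
Proof.
case=> [[g0 gB gs gf] gM g0E]; split=> //.
by move=> i j a b ga gb; rewrite addnC; apply: (gM j i b a).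
Qed.

Lemma converse_basis (V : A -> Prop) :
  is_basis_of x V -> @is_basis_of k n A^c x V.
Proof. by []. Qed.

Lemma converse_regular (f : A) : regular_elt f -> @regular_elt A^c f.
Proof. by move=> reg a [af|fa]; apply: reg; [right | left]. Qed.

Lemma converse_normal (f : A) : normal_elt f -> @normal_elt A^c f.
Proof. by move=> nf c; split=> [/nf|] [a ca]; [exists a | apply/nf; exists a]. Qed.

Lemma converse_mx_over a b (M : 'M['rV[k]_n]_(a, b)) :
  @mx_over k n A^c x _ _ M^T = (mx_over x M)^T.
Proof. by apply/matrixP => i j; rewrite !mxE. Qed.

Lemma converse_mulmx a b c (M : 'M[A]_(a, b)) (N : 'M[A]_(b, c)) :
  (N^T : 'M[A^c]_(c, b)) *m (M^T : 'M[A^c]_(b, a)) = (M *m N)^T.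
Proof. by rewrite trmx_mul_rev. Qed.

Lemma converse_relation g : @relation k n A^c x g <-> relation x g^T.
Proof.
rewrite /relation; split=> R; rewrite -[RHS]R exchange_big; apply: eq_bigr => i _;
  by apply: eq_bigr => j _; rewrite !mxE.
Qed.

Lemma converse_relation_zeros p q :
  @relation_zeros k n A^c x p q <-> relation_zeros x q p.
Proof.
split=> -[p0 q0 Z]; split=> // g Rg.
  rewrite -[RHS](Z g^T); last by apply/converse_relation; rewrite trmxK.
  rewrite exchange_big; apply: eq_bigr => i _; apply: eq_bigr => j _.
  by rewrite mxE [p 0 _ * _]mulrC.
rewrite -[RHS](Z g^T); last exact/converse_relation.
rewrite exchange_big; apply: eq_bigr => i _; apply: eq_bigr => j _.
by rewrite mxE [p 0 _ * _]mulrC.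
Qed.

Lemma converse_right_points p : @right_points k n A^c x p <-> left_points x p.
Proof.
rewrite left_pointsP right_pointsP.
by split=> -[q RZ]; exists q; apply/converse_relation_zeros.
Qed.

Variables (s : nat -> nat)
  (h : forall i, 'M['rV[k]_n]_(res_rank n s i.+1, res_rank n s i))
  (d : forall i, 'M['rV[k]_n]_(res_rank n s i, res_rank n s i.+1)).
Hypothesis dh : forall i, d i = (h i)^T.

(** Transposition exchanges rows with columns and reverses products. As [dh] is an equation and not
    a definition, either of [h] and [d] may be the given one. *)
Lemma converse_resolution :
  left_linear_resolution gA x h <-> @right_linear_resolution k n A^c gA x s d.
Proof.
have h0 : h 0 = \col_(j < n) delta_mx 0 j <-> d 0 = \row_(j < n) delta_mx 0 j.
  rewrite dh; split=> [->|dE]; first by apply/matrixP => i j; rewrite !mxE.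
  by rewrite -[h 0]trmxK dE; apply/matrixP => i j; rewrite !mxE.
have mulE i m (w : 'M[A]_(m, res_rank n s i.+1)) :
    @mx_over k n A^c x _ _ (d i) *m (w^T : 'M[A^c]_(_, _)) = (w *m mx_over x (h i))^T.
  by rewrite dh converse_mx_over converse_mulmx.
have aug (a : A) : (exists w : 'rV[A]_(res_rank n s 1), const_mx a = w *m mx_over x (h 0)) <->
    (exists w : 'cV[A^c]_(res_rank n s 1), const_mx a = @mx_over k n A^c x _ _ (d 0) *m w).
  split=> -[w wE]; exists w^T.
    by rewrite mulE -wE trmx_const.
  by apply: trmx_inj; rewrite -mulE trmxK trmx_const.
have ker i (v : 'rV[A]_(res_rank n s i.+1)) : v *m mx_over x (h i) = 0 <->
    @mx_over k n A^c x _ _ (d i) *m (v^T : 'M[A^c]_(_, _)) = 0.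
  rewrite mulE; split=> [->|]; first exact: trmx0.
  by move/(congr1 trmx); rewrite trmxK trmx0.
have im i (v : 'rV[A]_(res_rank n s i.+1)) :
    (exists w : 'rV[A]_(res_rank n s i.+2), v = w *m mx_over x (h i.+1)) <->
    (exists w : 'cV[A^c]_(res_rank n s i.+2), v^T = @mx_over k n A^c x _ _ (d i.+1) *m w).
  split=> -[w wE]; exists w^T; first by rewrite mulE -wE.
  by apply: trmx_inj; rewrite wE -mulE trmxK.
split=> -[d0E augA ex]; split; try exact/h0.
- by move=> a; apply: iff_trans (augA a) (aug a).
- by move=> i v; have := ex i v^T; rewrite ker im trmxK.
- by move=> a; apply: iff_trans (augA a) (iff_sym (aug a)).
- by move=> i v; rewrite ker im.
Qed.

Lemma converse_point_exact i :
  left_point_exact_atS x h i <-> @right_point_exact_atS k n A^c x s d i.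
Proof.
have rk j p : \rank (mx_at p (d j)) = \rank (mx_at p (h j)).
  rewrite dh -mxrank_tr; congr (\rank _).
  by apply/matrixP => a b; rewrite !mxE.
by split=> H p /converse_right_points/H; rewrite !rk.
Qed.

End ConverseTransfer.

Lemma converse_quotient (k : fieldType) (A B : algType k) (f : A) (pi : {lrmorphism A -> B}) :
  is_quotient_by f pi -> @is_quotient_by k A^c B^c f (converse_morphism pi).
Proof.
case=> surj ker; split=> // a; split=> [/ker|[N [u [v aE]]]].
  move=> [N [u [v ->]]]; exists N, v, u; apply: eq_bigr => t _.
  by rewrite /GRing.mul /= mulrA.
apply/ker; exists N, v, u; rewrite aE; apply: eq_bigr => t _.
by rewrite /GRing.mul /= mulrA.
Qed.

(** The right-hand half, stated so as to apply to [A] and to its converse; the last premise is what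
    (G1) for the quotient supplies. *)
Lemma right_quotient_resolution (k : fieldType) (A : algType k) (gA : nat -> A -> Prop)
    (cgA : connected_graded gA) (n : nat) (x : 'I_n -> A) (x_basis : is_basis_of x (gA 1%N))
    (f : A) (f_deg2 : gA 2%N f) (f_regular : regular_elt f) (f_normal : normal_elt f)
    (B : algType k) (pi : {lrmorphism A -> B}) (B_quot : is_quotient_by f pi)
    (s : nat -> nat) (d : forall i, 'M['rV[k]_n]_(res_rank n s i, res_rank n s i.+1)) l :
  right_linear_resolution gA x d ->
  (forall i, (i < l)%N -> right_point_exact_atS x d i) ->
  (forall q, right_points (pi \o x) q ->
    exists2 o, right_points (pi \o x) o & relation_zeros (pi \o x) o q) ->
  exists D : forall i, 'M['rV[k]_n]_(res_rank n (quot_ranks n s) i,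
                                      res_rank n (quot_ranks n s) i.+1),
    right_linear_resolution (image_grading pi gA) (pi \o x) D /\
    forall i, (i < l)%N -> right_point_exact_atS (pi \o x) D i.
Proof.
move=> d_res exA pred.
have [F FE] := quadratic_lift cgA x_basis f_deg2 d_res.
exists (quot_diff x pi d F); split.
  exact: (quot_resolution cgA x_basis f_deg2 f_regular f_normal B_quot d_res FE).
exact: (quot_point_exact cgA x_basis f_deg2 f_regular f_normal B_quot d_res FE).
Qed.

Theorem theorem1p3
    (k : closedFieldType) (char0 : [pchar k] =i pred0)
    (A : algType k) (gA : nat -> A -> Prop) (koszulA : koszul gA)
    (n : nat) (x : 'I_n -> A) (x_basis : is_basis_of x (gA 1%N))
    (f : A) (f_deg2 : gA 2%N f)
    (f_regular : regular_elt f) (f_normal : normal_elt f)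
    (B : algType k) (pi : {lrmorphism A -> B}) (B_quot : is_quotient_by f pi)
    (XA_nonempty : exists p, right_points x p)
    (AX_nonempty : exists p, left_points x p)
    (XB_nonempty : exists p, right_points (pi \o x) p)
    (BX_nonempty : exists p, left_points (pi \o x) p)
    (l : nat) (l_ge2 : (2 <= l)%N) :
  G1 x -> point_exact_upto gA x l ->
  G1 (pi \o x) /\ point_exact_upto (image_grading pi gA) (pi \o x) l.
Proof.
move=> G1x [s [d [h [d_res h_res exA]]]]; have [cgA _] := koszulA.
have G1y : G1 (pi \o x).
  have [F FE] := quadratic_lift cgA x_basis f_deg2 d_res.
  apply: (G1_restrict _ _ G1x) => [p q|p q u]; first exact: relation_zeros_quot.
  exact: (relation_zeros_shift cgA x_basis f_deg2 f_normal B_quot d_res FE).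
split=> //.
have [q /right_pointsP[o RZ]|D [D_res D_ex]] := right_quotient_resolution cgA x_basis
    f_deg2 f_regular f_normal B_quot d_res (fun i il => (exA i il).1).
  (* A predecessor [o] of [q] is itself a right point because (G1) gives it a predecessor in
     turn. *)
  have [o' RZ'] := G1_prev G1y RZ.
  by exists o => //; apply/right_pointsP; exists o'.
have h_res' := (converse_resolution gA x (fun i => erefl (h i)^T)).1 h_res.
have [||D' [D'_res D'_ex]] := right_quotient_resolution (converse_connected_graded cgA)
    (converse_basis x_basis) f_deg2 (converse_regular f_regular)
    (converse_normal f_normal) (converse_quotient B_quot) h_res' (l := l).
- move=> i il; have [_ exh] := exA i il.
  exact: (converse_point_exact x (fun i => erefl (h i)^T) i).1.
- move=> q /(converse_right_points (pi \o x))/left_pointsP[o RZ].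
  (* Pairs are reversed in the converse algebra, so successors take the place of predecessors. *)
  have [o' RZ'] := G1_next G1y RZ.
  exists o; first by apply/(converse_right_points (pi \o x))/left_pointsP; exists o'.
  exact/(converse_relation_zeros (pi \o x)).
pose H i := (D' i)^T; have DH i : D' i = (H i)^T by rewrite trmxK.
exists (quot_ranks n s), D, H; split=> // [|i il].
  exact: (converse_resolution (image_grading pi gA) (pi \o x) DH).2.
split; first exact: D_ex.
exact: (converse_point_exact (pi \o x) DH i).2 (D'_ex i il).
Qed.
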